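(* Let $G$ be a countably infinite amenable group with a Følner sequence $(F_N)_{N\in\mathbb{N}}$, and let $D\subseteq\mathbb{C}$ be compact. For each $l\in\mathbb{N}$ let $j_l\in\mathbb{N}$, let $h_{l,1},\dots,h_{l,j_l}\in G$ and let $p_l:D^{j_l}\to\mathbb{C}$ be continuous. Finally, let $\gamma:\mathbb{N}\to\mathbb{C}$ be a sequence of complex numbers. The following are equivalent: 1. There exists a sequence $(z_g)_{g\in G}$ of elements of $D$ such that, for all $l\in\mathbb{N}$, $$\lim_{N\to\infty}\frac{1}{|F_N|}\sum_{g\in F_N}p_l(z_{h_{l,1}g},\dots,z_{h_{l,j_l}g})=\gamma(l).$$ 2. There exists a measure preserving system $(X,\mathcal{B},\mu,(T_g)_{g\in G})$ and a measurable function $f:X\to D$ such that, for all $l\in\mathbb{N}$, $$\int_Xp_l\big(f(T_{h_{l,1}}x),\dots,f(T_{h_{l,j_l}}x)\big)\,d\mu(x)=\gamma(l).$$ 3. For all nonempty finite $A\subseteq G$ and for all $L\in\mathbb{N}$ and $\delta>0$ there exist some $K\in\mathbb{N}$ and sequences $(z_{g,k})_{g\in G}$ in $D$, for $k=1,\dots,K$, such that for all $l=1,\dots,L$ we have $$\left|\gamma(l)-\frac{1}{K|A|}\sum_{k=1}^{K}\sum_{g\in A}p_l(z_{h_{l,1}g,k},\dots,z_{h_{l,j_l}g,k})\right|<\delta.$$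
   Context: A (left) Følner sequence in a countable group $G$ is a sequence $(F_N)_{N\in\mathbb{N}}$ of (nonempty) finite subsets of $G$ such that $\lim_{N\to\infty}\frac{|gF_N\Delta F_N|}{|F_N|}=0$ for all $g\in G$; $G$ is (left) amenable if it has a Følner sequence. A measure preserving system $(X,\mathcal{B},\mu,(T_g)_{g\in G})$ is a probability space $(X,\mathcal{B},\mu)$ together with an action $(T_g)_{g\in G}$ of $G$ on $X$ by measure preserving maps (so $T_g\circ T_h=T_{gh}$). $\mathbb{N}=\{1,2,\dots\}$. *)

(* Defs.v *)
From HB Require Import structures.
From mathcomp Require Import all_boot all_order all_algebra finmap.
From mathcomp Require Import all_classical all_reals all_analysis.
From mathcomp.real_closed Require Import complex.

Set Implicit Arguments.
Unset Strict Implicit.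
Unset Printing Implicit Defensive.

Import Order.TTheory GRing.Theory Num.Theory.
Import numFieldNormedType.Exports.

Local Open Scope classical_set_scope.
Local Open Scope ring_scope.
Local Open Scope complex_scope.

Definition ltranslate (G : groupType) (g : G) (A : {fset G}) : {fset G} :=
  [fset (g * x)%g | x in A]%fset.

Definition fsymdiff (G : choiceType) (A B : {fset G}) : {fset G} :=
  ((A `\` B) `|` (B `\` A))%fset.

Definition left_Folner (R : realType) (G : groupType)
    (F : nat -> {fset G}) : Prop :=
  (forall N, F N != fset0) /\
  forall g : G,
    (fun N => #|` fsymdiff (ltranslate g (F N)) (F N)|%:R / #|` F N|%:R : R)
      @ \oo --> (0 : R).

(* R[i] with its structure of numClosedFieldType made manifest: the library's
   topology and normed-module instances are declared for abstract number fields
   and are not found on the bare R[i]. *)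
Definition Cplx (R : realType) : numClosedFieldType := R[i].
Arguments Cplx : simpl never.

(* D^j as a subset of C^j, tuples being row vectors. *)
Definition cpower (R : realType) (D : set (Cplx R)) (j : nat) :
    set 'rV[Cplx R]_j :=
  [set v | forall i, D (v ord0 i)].
Arguments cpower {R} D j.

(* The Borel sigma-algebra of C, generated by the open sets, since the library
   puts no measurable structure on R[i]. *)
Definition complex_Borel (R : realType) := g_sigma_algebraType (@open (Cplx R)).

Definition complex_measurable_fun (R : realType) (d : measure_display)
    (X : measurableType d) (f : X -> Cplx R) :=
  measurable_fun [set: X] (f : X -> complex_Borel R).

Definition complex_integral (R : realType) (d : measure_display)
    (X : measurableType d) (mu : probability X R) (f : X -> Cplx R) : Cplx R :=
  (\int[mu]_x complex.Re (f x))%R +i* (\int[mu]_x complex.Im (f x))%R.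

Definition measure_preserving (R : realType) (d : measure_display)
    (X : measurableType d) (mu : probability X R) (S : X -> X) :=
  measurable_fun [set: X] S /\
  forall B, measurable B -> mu (S @^-1` B) = mu B.

Definition measure_preserving_action (R : realType) (G : groupType)
    (d : measure_display) (X : measurableType d) (mu : probability X R)
    (T : G -> X -> X) :=
  [/\ forall g, measure_preserving mu (T g),
      T 1%g = id &
      forall g h, T g \o T h = T (g * h)%g].

(* Main.v *)
(* From a point z, an ultrafilter U on the indices turns the averages along F
   into a finitely additive invariant mean on G; this mean extends to a
   probability on the sequences x : nat -> G (Loeb's construction), on which G
   acts by translation, and f x is the U-limit of z (x N).

   From a system, finitely many points x_k with averages close to the integrals
   are picked greedily, keeping the squared norm of the sum of the deviations
   linear in K.

   From the averages over finite sets to a point: by the Ornstein-Weiss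
   quasitiling theorem G is covered, up to small upper Banach density, by
   disjoint invariant tiles of bounded shape.  A much larger invariant tile is a
   union of such tiles, and filling these with patterns taken from the third
   statement, chosen greedily again, yields a pattern whose own averages over the
   large tile are correct.  Tilings of better and better precision are then
   glued, the precision used near x growing with the first N for which F N
   contains x, so slowly that every F N sees only two consecutive scales, apart
   from a negligible part. *)
Require Import Defs.
From HB Require Import structures.
From mathcomp Require Import all_boot all_order all_algebra finmap.
From mathcomp Require Import all_classical all_reals all_analysis.
From mathcomp.real_closed Require Import complex.
From mathcomp Require Import measurable_realfun ring lra.

Set Implicit Arguments.
Unset Strict Implicit.
Unset Printing Implicit Defensive.

Import Order.TTheory GRing.Theory Num.Theory.
Import numFieldNormedType.Exports.

Local Open Scope classical_set_scope.
Local Open Scope ring_scope.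
Local Open Scope complex_scope.

(** * Invariant finite sets and tilings *)

Section FiniteSets.
Variables (R : realType) (G : groupType).
Implicit Types (K F T : {fset G}) (x y g : G).

(** A generic point cannot be taken directly from a system: the pointwise ergodic theorem fails
    along a general Følner sequence, and the measure may not be ergodic. The third statement avoids
    both difficulties, and averages over several sequences because a non-ergodic integral is not the
    average along one orbit. The price is that it controls only a joint average of [K] patterns,
    whereas a point carries a single pattern on each finite set. The average over [k] therefore has
    to be traded for an average over many small tiles inside one large tile.

    The sets [F N] need not be nested or grow regularly, so a late [F N] may overlap any part of the
    earlier ones. Hence the change of scale cannot be cut along the sets [F N]: it is decided tile
    by tile, and a large tile touching the region reserved for smaller scales is broken up into
    tiles of the preceding scale, which cover it well because it is invariant enough for them. *)

Definition core K F : {fset G} :=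
  [fset x in F | all (fun k => (k * x)%g \in F) (enum_fset K)]%fset.

(** The [(K, eta)]-invariance of Ornstein and Weiss. With [K] acting on the left it passes to right
    translates of [F], and a function at [x] that reads a sequence on [K x] sees only [F] when [x]
    is in the core. *)
Definition invariant_under K (eta : R) F :=
  #|` (F `\` core K F)%fset|%:R <= eta * #|` F|%:R.

Lemma in_core K F x :
  reflect (x \in F /\ forall k, k \in K -> (k * x)%g \in F) (x \in core K F).
Proof.
rewrite /core !inE /=; apply: (iffP andP) => [[xF /allP h]|[xF h]]; split => //.
by apply/allP.
Qed.

Lemma core_subset K F : (core K F `<=` F)%fset.
Proof. by apply/fsubsetP => x /in_core []. Qed.

Lemma core_le K K' F : (K `<=` K')%fset -> (core K' F `<=` core K F)%fset.
Proof.
move=> /fsubsetP KK'; apply/fsubsetP => x /in_core [xF h].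
by apply/in_core; split => // k /KK' /h.
Qed.

Lemma card_fset_le (F F' : {fset G}) : (F `<=` F')%fset ->
  #|` F|%:R <= #|` F'|%:R :> R.
Proof. by move=> /fsubset_leq_card; rewrite ler_nat. Qed.

Lemma invariant_underS K K' (eta eta' : R) F :
  (K `<=` K')%fset -> eta' <= eta ->
  invariant_under K' eta' F -> invariant_under K eta F.
Proof.
move=> KK' ee /le_trans H; apply: le_trans (H _ (ler_wpM2r _ ee)) => //.
by rewrite card_fset_le// fsetDS// core_le.
Qed.

Lemma card_fsetU_le (A B : {fset G}) :
  #|` (A `|` B)%fset|%:R <= #|` A|%:R + #|` B|%:R :> R.
Proof. by rewrite -natrD ler_nat cardfsU leq_subr. Qed.

Lemma card_rtranslate F x : #|` [fset (y * x)%g | y in F]%fset| = #|` F|.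
Proof. by rewrite card_imfset//=; exact: mulIg. Qed.

Lemma card_ltranslate F x : #|` ltranslate x F| = #|` F|.
Proof. by rewrite card_imfset//=; exact: mulgI. Qed.

Lemma in_ltranslate F x y : (y \in ltranslate x F) = (x^-1 * y \in F)%g.
Proof.
apply/imfsetP/idP => /= [[z zF ->]|h]; first by rewrite mulKg.
by exists (x^-1 * y)%g => //; rewrite mulVKg.
Qed.

Lemma in_rtranslate F x y :
  (y \in [fset (z * x)%g | z in F]%fset) = (y * x^-1 \in F)%g.
Proof.
apply/imfsetP/idP => /= [[z zF ->]|h]; first by rewrite mulgK.
by exists (y * x^-1)%g => //; rewrite mulgVK.
Qed.

Lemma card_seq_fset_sum (P : G -> pred G) (K F : {fset G}) :
  #|` [fset x in F | has (fun k => P k x) (enum_fset K)]%fset|%:R <=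
  \sum_(k <- K) #|` [fset x in F | P k x]%fset|%:R :> R.
Proof.
elim: (enum_fset K) => [|k s IH].
  rewrite big_nil /= (_ : [fset x in F | false]%fset = fset0) ?cardfs0//.
  by apply/fsetP => x; rewrite !inE /= andbF.
rewrite big_cons /=; apply: le_trans (lerD (lexx _) IH).
apply: le_trans (card_fsetU_le _ _).
apply: card_fset_le; apply/fsubsetP => x; rewrite !inE /=.
by case: (x \in F).
Qed.

Lemma card_escape (k : G) F :
  #|` [fset x in F | (k * x)%g \notin F]%fset| = #|` (ltranslate k F `\` F)%fset|.
Proof.
rewrite -(card_ltranslate _ k); congr (#|` _|); apply/fsetP => x.
by rewrite in_ltranslate !inE /= in_ltranslate mulVKg andbC.
Qed.

Lemma card_notin_core K F :
  #|` (F `\` core K F)%fset|%:R <=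
  \sum_(k <- K) #|` [fset x in F | (k * x)%g \notin F]%fset|%:R :> R.
Proof.
apply: le_trans (card_seq_fset_sum (fun k x => (k * x)%g \notin F) K F).
apply: card_fset_le; apply/fsubsetP => x; rewrite !inE /=.
by case: (x \in F); rewrite ?andbF// !andbT /= -has_predC.
Qed.

Lemma Folner_invariant (F : nat -> {fset G}) : left_Folner R F ->
  forall K (eta : R), 0 < eta ->
  exists N0, forall N, (N0 <= N)%N -> invariant_under K eta (F N).
Proof.
move=> [F0 FF] K eta eta0.
(* The complement of the core is covered by [#|K|] escape sets of proportion at most [e] each; the
   [+ 1] takes care of an empty [K]. *)
pose e := eta / (#|` K|%:R + 1).
have c0 : 0 < #|` K|%:R + 1 :> R by rewrite ltr_wpDl.
have e0 : 0 < e by rewrite divr_gt0.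
have H (s : seq G) : exists N0, forall N, (N0 <= N)%N -> forall k, k \in s ->
   #|` [fset x in F N | (k * x)%g \notin F N]%fset|%:R <= e * #|` F N|%:R.
  elim: s => [|k s [N0 h0]]; first by exists 0%N.
  have /cvgrPdist_lt /(_ e e0) [N1 _ h1] := FF k.
  exists (maxn N0 N1) => N; rewrite geq_max => /andP[n0 n1] k'.
  rewrite inE => /orP[/eqP->|/(h0 _ n0)//].
  have := h1 N n1; rewrite /= sub0r normrN => /ltW.
  have cF : 0 < #|` F N|%:R :> R by rewrite ltr0n cardfs_gt0.
  rewrite ger0_norm ?divr_ge0// ler_pdivrMr// => /(le_trans _); apply.
  by rewrite card_escape card_fset_le// /fsymdiff fsubsetUl.
have [N0 h0] := H (enum_fset K); exists N0 => N /h0 {}h0.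
apply: le_trans (card_notin_core K (F N)) _.
apply: (@le_trans _ _ (\sum_(k <- K) e * #|` F N|%:R)).
  rewrite big_seq [leRHS]big_seq; apply: ler_sum => k; exact: h0.
rewrite big_const_seq count_predT iter_addr_0 -[leLHS]mulr_natr mulrAC.
rewrite ler_wpM2r// /e -mulrA ler_piMr ?(ltW eta0)// mulrC.
by rewrite ler_pdivrMr// mul1r lerDl.
Qed.
End FiniteSets.

Section Tilings.
Variables (R : realType) (G : groupType).
Implicit Types (K F M T S A : {fset G}) (x y g : G) (t : G -> {fset G}).

(** A partial partition of [G], given by the tile of each point: the clauses force [t x] to contain
    [x] or to be empty, the latter at uncovered points. A single [M] bounds all tiles, as [t x] lies
    in [M x]. *)
Definition is_tiling M t := forall x y, y \in t x ->
  [/\ x \in t x, t y = t x & (y * x^-1)%g \in M].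

Definition tiled t F : {fset G} :=
  [fset x in F | (x \in t x) && (t x `<=` F)%fset]%fset.

Lemma in_tiled t F x :
  (x \in tiled t F) = [&& x \in F, x \in t x & (t x `<=` F)%fset].
Proof. by rewrite /tiled !inE. Qed.

Lemma tiled_subset t F : (tiled t F `<=` F)%fset.
Proof. by apply/fsubsetP => x; rewrite in_tiled => /and3P[]. Qed.

Lemma tile_tiled M t F x : is_tiling M t -> x \in tiled t F ->
  (t x `<=` tiled t F)%fset.
Proof.
move=> tM; rewrite in_tiled => /and3P[xF xt tF]; apply/fsubsetP => y yt.
have [_ tyx _] := tM _ _ yt.
by rewrite in_tiled (fsubsetP tF)// tyx yt.
Qed.

(** Induction on [#|A|]: removing one tile from a union of whole tiles leaves a union of whole
    tiles, because tiles sharing a point coincide. *)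
Lemma closed_tile_sum M t A (a : G -> R) alpha : is_tiling M t ->
  {in A, forall x, x \in t x /\ (t x `<=` A)%fset} ->
  {in A, forall x, `|\sum_(y <- t x) a y| <= alpha * #|` t x|%:R} ->
  `|\sum_(y <- A) a y| <= alpha * #|` A|%:R.
Proof.
move=> tM; have [n] := ubnP #|` A|; elim: n A => // n IH A /ltnSE An At aA.
have [->|[x xA]] := fset_0Vmem A.
  by rewrite big_seq_fset0 normr0 cardfs0 mulr0.
have [xt tA] := At x xA.
have tAE : [fset y in A | y \in t x]%fset = t x.
  apply/fsetP => y; rewrite !inE /=; apply/andP/idP => [[]//|yt].
  by rewrite (fsubsetP tA).
have tDE : [fset y in A | ~~ (y \in t x)]%fset = (A `\` t x)%fset.
  by apply/fsetP => y; rewrite !inE /= andbC.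
rewrite (big_fsetID _ (mem (t x)))/= tAE tDE.
have cA : #|` A| = (#|` t x| + #|` A `\` t x|%fset)%N.
  by rewrite -(cardfsID (t x) A) (fsetIidPr tA).
apply: le_trans (ler_normD _ _) _; rewrite cA natrD mulrDr.
apply: lerD; first exact: aA.
apply: IH => [|y|y]; rewrite ?inE.
- apply: leq_trans An; rewrite cA -[ltnLHS]add0n ltn_add2r cardfs_gt0.
  by apply/fset0Pn; exists x.
- move=> /andP[ytx yA]; have [yt tyA] := At y yA; split => //.
  apply/fsubsetP => w wt; rewrite inE (fsubsetP tyA)// andbT.
  apply/negP => wtx; have [_ tw _] := tM _ _ wt; have [_ tw' _] := tM _ _ wtx.
  by move: ytx; rewrite -tw' tw yt.
- by move=> /andP[_ yA]; exact: aA.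
Qed.

Lemma tiled_sum M t F (a : G -> R) alpha : is_tiling M t -> 0 <= alpha ->
  (forall x, x \in t x -> (t x `<=` F)%fset ->
     `|\sum_(y <- t x) a y| <= alpha * #|` t x|%:R) ->
  `|\sum_(y <- tiled t F) a y| <= alpha * #|` F|%:R.
Proof.
move=> tM alpha0 h.
apply: (@le_trans _ _ (alpha * #|` tiled t F|%:R)); last first.
  by rewrite ler_wpM2l// card_fset_le// tiled_subset.
apply: (closed_tile_sum tM) => x xt.
  by split; [move: xt; rewrite in_tiled => /and3P[]|exact: tile_tiled tM xt].
by move: xt; rewrite in_tiled => /and3P[_ xt tF]; exact: h.
Qed.

Lemma norm_sum_le A (a : G -> R) c : (forall x, x \in A -> `|a x| <= c) ->
  `|\sum_(y <- A) a y| <= c * #|` A|%:R.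
Proof.
move=> ac; apply: le_trans (ler_norm_sum _ _ _) _.
apply: (@le_trans _ _ (\sum_(y <- A) c)).
  by rewrite big_seq [leRHS]big_seq; apply: ler_sum => k; exact: ac.
by rewrite big_const_seq count_predT iter_addr_0 -[leLHS]mulr_natr.
Qed.

Lemma sum_fsetD A B (a : G -> R) : (B `<=` A)%fset ->
  \sum_(y <- A) a y = \sum_(y <- B) a y + \sum_(y <- (A `\` B)%fset) a y.
Proof.
move=> BA; rewrite (big_fsetID _ (mem B))/=; congr (_ + _).
  congr bigop; congr enum_fset; apply/fsetP => y; rewrite !inE /=.
  by apply/andP/idP => [[]//|yB]; rewrite (fsubsetP BA).
by congr bigop; congr enum_fset; apply/fsetP => y; rewrite !inE /= andbC.
Qed.

Lemma tilewise_sum M t F (a : G -> R) alpha beta c : is_tiling M t ->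
  0 <= alpha -> 0 <= c ->
  (forall x, x \in F -> `|a x| <= c) ->
  #|` (F `\` tiled t F)%fset|%:R <= beta * #|` F|%:R ->
  (forall x, x \in t x -> (t x `<=` F)%fset ->
     `|\sum_(y <- t x) a y| <= alpha * #|` t x|%:R) ->
  `|\sum_(y <- F) a y| <= (alpha + c * beta) * #|` F|%:R.
Proof.
move=> tM alpha0 c0 ac Fb h.
rewrite (sum_fsetD _ (tiled_subset t F)) mulrDl.
apply: le_trans (ler_normD _ _) _; apply: lerD; first exact: (tiled_sum tM).
rewrite -mulrA; apply: le_trans (ler_wpM2l c0 Fb).
by apply: norm_sum_le => x; rewrite inE => /andP[_ /ac].
Qed.

(** The tile of [x] lies in [M x], so it can stick out of [F] only if [x] is outside the core. *)
Lemma untiled_notin_core M t F : is_tiling M t ->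
  ([fset x in F | x \in t x] `\` tiled t F `<=` F `\` core M F)%fset.
Proof.
move=> tM; apply/fsubsetP => x; rewrite !inE /= => /andP[+ /andP[xF xt]].
rewrite xF xt /= => /fsubsetPn [y yt yF]; rewrite andbT; apply/allPn.
have [_ _ yM] := tM _ _ yt.
by exists (y * x^-1)%g => //; rewrite mulgVK.
Qed.

End Tilings.

(** * Ornstein-Weiss quasitilings *)

Section Quasitilings.
Variables (R : realType) (G : groupType).
Implicit Types (K F M T S A : {fset G}) (x y g : G) (t : G -> {fset G}).
Implicit Types (W : set ({fset G} * {fset G})).

Definition covered_by W : set G := [set x | exists2 p, W p & x \in p.1].

(* A pair (T, S) of W is a tile T together with its hull S.  The tiles are
   disjoint and fill all but a proportion eps of their hulls; invariance is only
   required of the hulls, so that eps need not depend on K. *)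
Definition quasitiling (eps : R) K (eta : R) M W :=
  [/\ forall p, W p -> [/\ p.1 != fset0, (p.1 `<=` p.2)%fset,
        invariant_under K eta p.2, (1 - eps) * #|` p.2|%:R <= #|` p.1|%:R &
        forall x y, x \in p.2 -> y \in p.2 -> (y * x^-1)%g \in M],
      forall p, W p -> [set` p.2] `<=` covered_by W &
      forall p q x, W p -> W q -> x \in p.1 -> x \in q.1 -> p = q].

Lemma quasitilingS eps K K' eta eta' M M' W :
  (K `<=` K')%fset -> eta' <= eta -> (M `<=` M')%fset ->
  quasitiling eps K' eta' M W -> quasitiling eps K eta M' W.
Proof.
move=> KK ee MM [h1 h2 h3]; split => // p /h1 [? ? ? ? h]; split => //.
  exact: (invariant_underS KK ee).
by move=> x y xp yp; apply: (fsubsetP MM); exact: h.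
Qed.

Lemma invariant_rtranslate K (eta : R) S c : invariant_under K eta S ->
  invariant_under K eta [fset (s * c)%g | s in S]%fset.
Proof.
rewrite /invariant_under card_rtranslate; apply: le_trans.
rewrite -(card_rtranslate (S `\` core K S)%fset c).
apply: card_fset_le; apply/fsubsetP => x; rewrite !(in_rtranslate, inE) /=.
move=> /andP[+ xS]; rewrite !xS /= andbT.
apply: contraNN => /allP h; apply/allP => k /h.
by rewrite in_rtranslate mulgA.
Qed.

(** Zorn's lemma on the families added to [W0]; unions of chains cause no trouble because every
    clause involves at most two pairs at a time. If some [S c] met the covered part in a proportion
    at most [eps], its uncovered part, with hull [S c], could still be added. *)
Lemma quasitiling_maximal eps K eta M W0 S :
  0 < eps < 1 ->
  S != fset0 -> invariant_under K eta S -> quasitiling eps K eta M W0 ->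
  exists W, [/\ W0 `<=` W,
    quasitiling eps K eta (M `|` [fset (s * s'^-1)%g | s in S, s' in S])%fset W &
    forall c, eps * #|` S|%:R <
       #|` [fset x in [fset (s * c)%g | s in S] | `[< covered_by W x >] ]%fset|%:R].
Proof.
move=> /andP[eps0 eps1] S0 SK qW0.
(* The quotients of two points of [S c] lie in [S S^-1] whatever [c] is, so one finite set bounds
   all translates. *)
set M' := (M `|` _)%fset.
pose P X := quasitiling eps K eta M' (W0 `|` X).
have [|X [PX Xmax]] := @Zorn_bigcup _ P.
  move=> C CP Ctot; rewrite /P.
  have [[X0 CX0]|C0] := pselect (exists X, C X); last first.
    rewrite (_ : \bigcup_(X in C) X = set0) ?setU0.
      by apply: quasitilingS qW0; rewrite // fsubsetUl.
    by rewrite -subset0 => p [X CX]; case: C0; exists X.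
  have UE p : (W0 `|` \bigcup_(X in C) X) p -> exists2 X, C X & (W0 `|` X) p.
    by move=> [Wp|[X CX Xp]]; [exists X0 => //; left|exists X => //; right].
  have sub X : C X -> W0 `|` X `<=` W0 `|` \bigcup_(X in C) X.
    by move=> CX p [?|?]; [left|right; exists X].
  split.
  - by move=> p /UE[X /CP[+ _ _]]; apply.
  - move=> p /UE[X CX Xp]; have [_ h _] := CP _ CX.
    move=> x /(h _ Xp) [q Xq xq]; exists q => //; exact: sub Xq.
  - move=> p q x /UE[X CX Xp] /UE[Y CY Yq]; have [] := Ctot _ _ CX CY => XY.
      have [_ _] := CP _ CY; apply => //.
      by case: Xp => ?; [left|right; exact: XY].
    have [_ _] := CP _ CX; apply => //.
    by case: Yq => ?; [left|right; exact: XY].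
exists (W0 `|` X); split => //.
move=> c; rewrite ltNge; apply/negP => small.
set W := W0 `|` X in small.
set Sc := [fset (s * c)%g | s in S]%fset in small.
set B := [fset x in Sc | _]%fset in small.
have BS : (B `<=` Sc)%fset by apply/fsubsetP => x; rewrite !inE => /andP[].
have cSc : #|` Sc| = #|` S| by rewrite card_rtranslate.
pose T := (Sc `\` B)%fset.
have TE x : x \in T -> x \in Sc /\ ~ covered_by W x.
  by rewrite !inE /=; case: (x \in Sc); rewrite ?andbF//= andbT => /asboolPn.
have S0' : 0 < #|` S|%:R :> R by rewrite ltr0n cardfs_gt0.
have cT : (1 - eps) * #|` Sc|%:R <= #|` T|%:R :> R.
  rewrite cardfsDS// natrB ?fsubset_leq_card// cSc.
  by rewrite mulrBl mul1r lerD2l lerN2.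
have T0 : T != fset0.
  rewrite -cardfs_gt0 -(ltr_nat R); apply: lt_le_trans cT.
  by rewrite cSc mulr_gt0// subr_gt0.
have [x0 x0T] := fset0Pn _ T0.
have [x0S x0W] := TE _ x0T.
have := Xmax (X `|` [set (T, Sc)]); apply.
  split; first by move=> ?; left.
  move=> H; by apply: x0W; exists (T, Sc) => //; right; apply: H; right.
rewrite /P setUA -/W; case: PX => h1 h2 h3; split.
- move=> p [/h1//|->] /=; split => //.
  + exact: fsubsetDl.
  + exact: invariant_rtranslate.
  + move=> x y; rewrite !in_rtranslate => xS yS; rewrite !inE; apply/orP; right.
    apply/imfset2P; exists (y * c^-1)%g => //.
    by exists (x * c^-1)%g => //; rewrite mulgKA.
- move=> p [/h2 h x /h [q Wq xq]|-> x /= xS]; first by exists q => //; left.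
  have [[q Wq xq]|nW] := pselect (covered_by W x); first by exists q => //; left.
  exists (T, Sc); first by right.
  by rewrite /T !inE /= xS andbT; apply/negP => /asboolP.
- move=> p q x [Wp|->] [Wq|->] //= xp xq; first exact: h3 Wp Wq xp xq.
  + by have [_] := TE _ xq; case; exists p.
  + by have [_] := TE _ xp; case; exists q.
Qed.

End Quasitilings.

Section TileOf.
Variables (R : realType) (G : groupType).
Implicit Types (K F M T S A U : {fset G}) (x y g : G) (t : G -> {fset G}).
Implicit Types (W : set ({fset G} * {fset G})).

Definition tile_of W x : {fset G} :=
  if pselect (exists2 p, W p & x \in p.1) is left e then (s2val (cid2 e)).1
  else fset0.

Lemma tile_ofP (eps : R) K eta M W p x : quasitiling eps K eta M W ->
  W p -> x \in p.1 -> tile_of W x = p.1.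
Proof.
move=> [_ _ h] Wp xp; rewrite /tile_of; case: pselect => [e|[]]; last by exists p.
by case: cid2 => q /= Wq xq; rewrite (h _ _ _ Wq Wp xq xp).
Qed.

Lemma mem_tile_of W x y : y \in tile_of W x ->
  exists p, [/\ W p, tile_of W x = p.1, x \in p.1 & y \in p.1].
Proof.
rewrite /tile_of; case: pselect => // e; case: cid2 => p /= Wp xp yp.
by exists p.
Qed.

Lemma tile_of_tiling (eps : R) K eta M W : quasitiling eps K eta M W ->
  is_tiling M (tile_of W).
Proof.
move=> qW x y /mem_tile_of [p [Wp tx xp yp]]; rewrite tx; split => //.
  exact: tile_ofP qW Wp yp.
by have [/(_ p Wp) [_ /fsubsetP pp _ _ +] _ _] := qW; apply; exact: pp.
Qed.

Lemma mem_tile_ofxx (eps : R) K eta M W x : quasitiling eps K eta M W ->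
  x \in tile_of W x <-> covered_by W x.
Proof.
move=> qW; split => [/mem_tile_of [p [Wp _ xp _]]|[p Wp xp]]; first by exists p.
by rewrite (tile_ofP qW Wp xp).
Qed.

Lemma card_filter A (C : pred G) :
  #|` [fset x in A | C x]%fset|%:R = \sum_(x <- A) (C x)%:R :> R.
Proof.
rewrite card_fset_sum1 natr_sum -big_fset_condE big_mkcond.
by apply: eq_bigr => x _; case: (C x).
Qed.

(** The left side counts [A \ sA], the right side a translate of [sA \ A]; these have the same size
    because [A] and [sA] do. *)
Lemma card_inv_escape A s :
  #|` [fset y in A | (s^-1 * y)%g \notin A]%fset| =
  #|` [fset y in A | (s * y)%g \notin A]%fset|.
Proof.
rewrite (card_escape s) cardfsD card_ltranslate fsetIC -cardfsD; congr (#|` _|).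
by apply/fsetP => y; rewrite !inE /= in_ltranslate andbC.
Qed.

(** Count the pairs [(s, c)] with [c] in the core and [C (s * c)]. Each [c] gives at least
    [eps * #|S|] of them; each [s] gives at most as many as there are points of [U] satisfying [C],
    since [c |-> s * c] maps the core injectively into [U]. *)
Lemma double_counting (eps : R) S U (C : pred G) :
  S != fset0 ->
  (forall c, eps * #|` S|%:R <=
     #|` [fset x in [fset (s * c)%g | s in S] | C x]%fset|%:R) ->
  eps * #|` core S U|%:R <= #|` [fset x in U | C x]%fset|%:R.
Proof.
move=> S0 h; have n0 : 0 < #|` S|%:R :> R by rewrite ltr0n cardfs_gt0.
rewrite -(ler_pM2r n0) mulrAC.
have -> : eps * #|` S|%:R * #|` core S U|%:R =
    \sum_(c <- core S U) eps * #|` S|%:R.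
  by rewrite big_const_seq count_predT iter_addr_0 mulr_natr.
apply: (@le_trans _ _ (\sum_(c <- core S U) \sum_(s <- S) (C (s * c)%g)%:R)).
  apply: ler_sum => c _; apply: le_trans (h c) _.
  by rewrite card_filter big_imfset//= => x y _ _; exact: mulIg.
rewrite exchange_big /= mulrC.
have -> : #|` S|%:R * #|` [fset x in U | C x]%fset|%:R =
    \sum_(c <- S) #|` [fset x in U | C x]%fset|%:R :> R.
  by rewrite big_const_seq count_predT iter_addr_0 mulr_natl.
rewrite big_seq [leRHS]big_seq; apply: ler_sum => s sS.
rewrite -card_filter -(card_ltranslate _ s).
apply: card_fset_le; apply/fsubsetP => x.
rewrite in_ltranslate !inE /= mulVKg => /andP[/andP[_ /allP h1] ->].
by rewrite andbT; have := h1 s sS; rewrite mulVKg.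
Qed.

(* A point outside the covered set that a translation moves inside enters a tile
   through the boundary of its hull, which is small. *)
Lemma card_enter_cov (eps : R) K eta M W F s : 0 <= eps <= 1/2 -> 0 <= eta ->
  quasitiling eps K eta M W -> s \in K ->
  #|` [fset y in F | `[< covered_by W y >] && ~~ `[< covered_by W (s^-1 * y)%g >]]%fset|%:R
  <= 2 * eta * #|` F|%:R + #|` (F `\` core M F)%fset|%:R.
Proof.
move=> /andP[eps0 eps1] eta0 qW sK.
have tW := tile_of_tiling qW.
set t := tile_of W in tW.
pose b y := `[< covered_by W y >] && ~~ `[< covered_by W (s^-1 * y)%g >].
have sub : ([fset y in F | b y] `<=`
    [fset y in tiled t F | b y] `|` (F `\` core M F))%fset.
  apply/fsubsetP => y yFb; have /andP[yF by_] : (y \in F) && b y by move: yFb; rewrite !inE.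
  apply/fsetUP; case yt : (y \in tiled t F); [left|right].
    by rewrite in_fset inE /= yt by_.
  apply: (fsubsetP (untiled_notin_core F tW)).
  rewrite in_fsetD yt in_fset inE /= yF /=; case/andP: by_ => /asboolP cy _.
  exact/(mem_tile_ofxx _ qW).
apply: le_trans (card_fset_le _ sub) _.
apply: le_trans (card_fsetU_le _ _ _) _; rewrite lerD2r card_filter.
rewrite -[leLHS]ger0_norm ?sumr_ge0//.
apply: (tiled_sum tW) => [|x xt tF]; first by rewrite mulr_ge0.
rewrite ger0_norm ?sumr_ge0// -card_filter.
have [p [Wp tx xp _]] := mem_tile_of xt.
have [/(_ p Wp) [_ pp pinv cp _] pcov _] := qW.
rewrite [t x]tx.
apply: (@le_trans _ _ #|` [fset y in p.2 | (s^-1 * y)%g \notin p.2]%fset|%:R).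
  apply: card_fset_le; apply/fsubsetP => y; rewrite !inE /= => /andP[yp].
  rewrite (fsubsetP pp)//= => /andP[_ /asboolPn]; apply: contra_notN => h.
  exact: (pcov p Wp _ h).
rewrite card_inv_escape.
apply: (@le_trans _ _ (eta * #|` p.2|%:R)).
  apply: le_trans pinv; apply: card_fset_le; apply/fsubsetP => y.
  rewrite !inE /= => /andP[-> sy]; rewrite andbT /=; apply/allPn.
  by exists s.
(* As [eps <= 1/2], a hull is at most twice as large as its tile: this is the factor 2 of the
   bound. *)
rewrite -mulrA mulrCA ler_wpM2l//.
have := ler0n R #|` p.2|; move: cp eps1; nra.
Qed.

End TileOf.

(** * Exhausting the group by tiles *)

Section Achievable.
Variables (R : realType) (G : groupType).
Implicit Types (K F M T S A U : {fset G}) (x y g : G) (t : G -> {fset G}).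
Implicit Types (W : set ({fset G} * {fset G})).

Definition uncovered W F : {fset G} :=
  [fset x in F | ~~ `[< covered_by W x >]]%fset.

(** The invariance [K], [eta] is quantified inside, so that the next step can first fix its set [S]
    and then demand hulls invariant under [S] from the tiles placed before it: the largest tiles
    come first. *)
Definition achievable (eps u : R) := forall K (eta : R), 0 < eta ->
  exists W M K' (eta' : R), [/\ 0 < eta', quasitiling eps K eta M W &
    forall F, invariant_under K' eta' F ->
      #|` uncovered W F|%:R <= u * #|` F|%:R].

Lemma sum_fset_const A (c : R) : \sum_(x <- A) c = #|` A|%:R * c.
Proof. by rewrite big_const_seq count_predT iter_addr_0 mulr_natl. Qed.

Hypothesis amenable : forall K (eta : R), 0 < eta ->
  exists2 S : {fset G}, S != fset0 & invariant_under K eta S.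

(* Translates of a set S, small with respect to the tiles already present, are
   added as long as they meet the covered part in a proportion at most eps.  When
   this stops, every translate of S inside the part left uncovered by the old
   tiles has a proportion eps of its points in the new ones. *)
Lemma achievable_step (eps u : R) : 0 < eps <= 1/2 -> achievable eps u ->
  achievable eps ((1 - eps) * u + eps ^+ 2).
Proof.
move=> /andP[eps0 eps1] Au K eta eta_gt0.
have [S S0 Sinv] := amenable K eta_gt0.
have n0 : 0 < #|` S|%:R :> R by rewrite ltr0n cardfs_gt0.
set n := #|` S|%:R : R in n0.
pose ep := eps / (8 * n); have ep0 : 0 < ep by rewrite divr_gt0// mulr_gt0.
pose eta0 := Num.min eta ep.
have eta00 : 0 < eta0 by rewrite lt_min eta_gt0.
have [W0 [M0 [K0 [eta1 [eta10 qW0 unc0]]]]] := Au (K `|` S)%fset eta0 eta00.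
have qW0' : quasitiling eps K eta M0 W0.
  by apply: quasitilingS qW0; rewrite ?fsubsetUl// ge_min lexx.
have eps1' : 0 < eps < 1 by lra.
have [W [W0W qW Wmax]] := quasitiling_maximal eps1' S0 Sinv qW0'.
exists W; eexists; exists (K0 `|` S `|` M0)%fset, (Num.min eta1 ep).
split; [by rewrite lt_min eta10|exact: qW|move=> F Finv].
have F0 : invariant_under K0 eta1 F.
  by apply: invariant_underS Finv; rewrite ?ge_min ?lexx// -fsetUA fsubsetUl.
have FS : invariant_under S ep F.
  apply: invariant_underS Finv; rewrite ?ge_min ?lexx ?orbT//.
  by rewrite fsetUAC fsubsetUr.
have FM : invariant_under M0 ep F.
  by apply: invariant_underS Finv; rewrite ?ge_min ?lexx ?orbT// fsubsetUr.
have {F0}/unc0 := F0; set U := uncovered W0 F => Uu.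
(* The uncovered part is itself almost invariant under [S]: a point leaves it under [s] either by
   leaving [F], which costs [ep], or by entering an old tile, which costs [3 * ep] by
   [card_enter_cov]. Summed over [S] this is below [eps]. *)
have Uinner : #|` (U `\` core S U)%fset|%:R <= eps * #|` F|%:R :> R.
  apply: le_trans (card_notin_core _ S U) _.
  have -> : eps * #|` F|%:R = \sum_(s <- S) (8 * ep) * #|` F|%:R :> R.
    rewrite big_const_seq count_predT iter_addr_0 -mulr_natr -/n /ep.
    by field; rewrite gt_eqF.
  rewrite big_seq [leRHS]big_seq; apply: ler_sum => s sS.
  have escF : #|` [fset x in F | (s * x)%g \notin F]%fset|%:R <= ep * #|` F|%:R.
    apply: le_trans FS; apply: card_fset_le; apply/fsubsetP => y.
    rewrite !inE /= => /andP[-> sy]; rewrite andbT /=; apply/allPn.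
    by exists s.
  have entF : #|` [fset y in F | `[< covered_by W0 y >] &&
      ~~ `[< covered_by W0 (s^-1 * y)%g >]]%fset|%:R <= (3 * ep) * #|` F|%:R.
    have sKS : s \in (K `|` S)%fset by rewrite inE sS orbT.
    have h : 0 <= eps <= 1/2 by lra.
    apply: le_trans (card_enter_cov F h (ltW eta00) qW0 sKS) _.
    apply: le_trans (lerD (lexx _) FM) _.
    rewrite -mulrDl ler_wpM2r//; have : eta0 <= ep by rewrite ge_min lexx orbT.
    by lra.
  rewrite -(card_ltranslate [fset y in F | _]%fset s^-1%g) in entF.
  apply: (@le_trans _ _ (4 * ep * #|` F|%:R)); last first.
    by rewrite ler_wpM2r// ler_wpM2r ?(ltW ep0)//; lra.
  rewrite (_ : 4 * ep * _ = ep * #|` F|%:R + 3 * ep * #|` F|%:R); last by ring.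
  apply: le_trans (lerD escF entF).
  apply: le_trans (card_fsetU_le _ _ _); apply: card_fset_le.
  apply/fsubsetP => x xU.
  have /andP[/andP[xF xc] sxU] :
    (x \in F) && ~~ `[< covered_by W0 x >] && ((s * x)%g \notin U).
    by move: xU; rewrite !inE.
  apply/fsetUP; case sxF : ((s * x)%g \in F); [right|left].
    rewrite in_ltranslate invgK in_fset inE /= sxF mulKg xc andbT /=.
    by apply: contraR sxU => h; rewrite in_fset inE /= sxF.
  by rewrite in_fset inE /= xF sxF.
have dc := double_counting U S0 (fun c => ltW (Wmax c)).
have UW : #|` uncovered W F|%:R = #|` U|%:R -
    #|` [fset x in U | `[< covered_by W x >]]%fset|%:R :> R.
  have sub : ([fset x in U | `[< covered_by W x >]] `<=` U)%fset.
    by apply/fsubsetP => x; rewrite in_fset => /andP[].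
  rewrite -natrB ?fsubset_leq_card// -cardfsDS//; congr (_%:R).
  congr (#|` _|); apply/fsetP => x; rewrite !inE /=.
  case: (x \in F) => //=; case: (asboolP (covered_by W x)) => h; rewrite /= ?(andbT, andbF) /=.
    by case: asboolP.
  by apply/esym/negP => /asboolP [p pW xp]; apply: h; exists p => //; exact: W0W.
have cU : #|` U|%:R = #|` core S U|%:R + #|` (U `\` core S U)%fset|%:R :> R.
  by rewrite -natrD cardfsDS ?core_subset// subnKC// fsubset_leq_card// core_subset.
(* The new tiles cover at least [eps] times the core of [U], so what remains is at most
   [(1 - eps) * #|U| + eps * #|U \ core S U|]; the last term gives [eps ^+ 2]. *)
rewrite UW; move: dc Uinner cU Uu (ler0n R #|` F|).
move: (_%:R) (_%:R) (_%:R) (_%:R) (_%:R) => a b c d e.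
rewrite expr2; move: eps0 eps1; clear => eps0 eps1 dc Ui cU Uu b0.

nra.
Qed.

(** The recursion [u |-> (1 - eps) * u + eps ^+ 2] has fixed point [eps] and contracts by [1 - eps].
    It starts at [eps + 1], where the empty family suffices. *)
Lemma achievable_iter (eps : R) m : 0 < eps <= 1/2 ->
  achievable eps (eps + (1 - eps) ^+ m).
Proof.
move=> heps; elim: m => [|m IH].
  move=> K eta eta0; exists set0, fset0, fset0, 1; split => // F _.
  apply: (@le_trans _ _ #|` F|%:R).
    by apply: card_fset_le; apply/fsubsetP => x; rewrite in_fset => /andP[].
  by rewrite expr0 mulrDl mul1r lerDr mulr_ge0//; lra.
have := achievable_step heps IH.
suff -> : (1 - eps) * (eps + (1 - eps) ^+ m) + eps ^+ 2 =
  eps + (1 - eps) ^+ m.+1 by [].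
by rewrite [_ ^+ m.+1]exprS mulrDr [(1 - eps) * eps]mulrBl mul1r expr2 addrAC subrK.
Qed.

Theorem tilings_exist K (eta : R) : 0 < eta ->
  exists t M K' (eta' : R), [/\ 0 < eta', is_tiling M t,
    forall x, x \in t x -> invariant_under K eta (t x) &
    forall F, invariant_under K' eta' F ->
      #|` (F `\` tiled t F)%fset|%:R <= eta * #|` F|%:R].
Proof.
move=> eta0.
have k0 : 0 < #|` K|%:R + 1 :> R by rewrite ltr_wpDl.
(* Invariance now passes from hulls to tiles, and [eps] may depend on [K]: a point outside the core
   of its tile is outside the core of the hull, or some [k] sends it into the part cut off from the
   hull. The latter is charged once for each [k]. *)
pose eps := Num.min (1/2) (eta / (8 * (#|` K|%:R + 1))).
have e0 : 0 < eta / (8 * (#|` K|%:R + 1)) by rewrite divr_gt0// mulr_gt0.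
have eps0 : 0 < eps by rewrite lt_min; lra.
have eps1 : eps <= 1/2 by rewrite ge_min lexx.
have eps2 : eps * (#|` K|%:R + 1) <= eta / 8.
  apply: (@le_trans _ _ (eta / (8 * (#|` K|%:R + 1)) * (#|` K|%:R + 1))).
    by rewrite ler_wpM2r ?(ltW k0)// ge_min lexx orbT.
  by rewrite invfM mulrA mulfVK// gt_eqF.
have eps3 : eps <= eta / 8.
  by apply: le_trans eps2; rewrite ler_peMr ?(ltW eps0)// lerDr.
have [m hm] : exists m, (1 - eps) ^+ m <= eps.
  have : (fun n => (1 - eps) ^+ n) @ \oo --> (0 : R).
    by apply: cvg_expr; rewrite ger0_norm; lra.
  move=> /cvgrPdist_le /(_ eps eps0) [m _ /(_ m (leqnn m))] /=.
  by rewrite sub0r normrN; exists m; apply: le_trans (ler_norm _) _.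
have heps : 0 < eps <= 1/2 by rewrite eps0.
have [W [M [K' [eta' [eta'0 qW unc]]]]] := achievable_iter m heps K eps0.
have tW := tile_of_tiling qW.
exists (tile_of W), M, (K' `|` M)%fset, (Num.min eta' eps); split.
- by rewrite lt_min eta'0.
- by [].
- move=> x /mem_tile_of [p [Wp -> _ _]].
  have [/(_ p Wp) [_ pp pinv cp _] _ _] := qW.
  have sub : (p.1 `\` core K p.1 `<=` (p.2 `\` core K p.2) `|`
     [fset y in p.1 | has (fun k => (k * y)%g \in (p.2 `\` p.1)%fset)
        (enum_fset K)])%fset.
    apply/fsubsetP => y /fsetDP[yp /in_core nc].
    have yp2 := fsubsetP pp _ yp.
    apply/fsetUP; case yc : (y \in core K p.2); [right|left]; last first.
      by rewrite in_fsetD yc.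
    have {yc}/in_core[_ yc] := yc.
    rewrite in_fset inE /= yp /=; apply: contra_notT nc => /hasPn h.
    split => // k kK; have := h k kK; rewrite in_fsetD yc// andbT negbK.
    by [].
  apply: le_trans (card_fset_le _ sub) _.
  apply: le_trans (card_fsetU_le _ _ _) _.
  apply: le_trans (lerD pinv (card_seq_fset_sum _ _ _ _)) _.
  have cD : #|` (p.2 `\` p.1)%fset|%:R <= eps * #|` p.2|%:R :> R.
    rewrite cardfsDS// natrB ?fsubset_leq_card//.
    by move: cp; rewrite mulrBl mul1r; lra.
  have : \sum_(k <- K) #|` [fset y in p.1 | (k * y)%g \in (p.2 `\` p.1)%fset]%fset|%:R
       <= #|` K|%:R * (eps * #|` p.2|%:R) :> R.
    rewrite -sum_fset_const; apply: ler_sum => k _; apply: le_trans cD.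
    rewrite -(card_ltranslate _ k); apply: card_fset_le; apply/fsubsetP => y.
    rewrite in_ltranslate in_fset => /andP[_] /=.
    by rewrite mulVKg.
  move: cp eps0 eps1 eps2 k0 (ler0n R #|` p.2|).
  move: (#|` p.2|%:R) (#|` p.1|%:R) (#|` K|%:R) => c a b.
  move=> h1 h2 h3 h4 h5 h6 h7.
  have h8 : eps * (b + 1) * c <= eta / 8 * c by rewrite ler_wpM2r.
  have h9 : c <= 2 * a by nra.
  have h10 : eta * c <= eta * (2 * a) by rewrite ler_wpM2l// ltW.
  have a0 : 0 <= a by lra.
  have h11 : 0 <= eta * a by rewrite mulr_ge0// ltW.
  by nra.
- move=> F Finv.
  have F1 : invariant_under K' eta' F.
    by apply: invariant_underS Finv; rewrite ?fsubsetUl// ge_min lexx.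
  have F2 : invariant_under M eps F.
    by apply: invariant_underS Finv; rewrite ?fsubsetUr// ge_min lexx orbT.
  have sub : (F `\` tiled (tile_of W) F `<=`
      uncovered W F `|` (F `\` core M F))%fset.
    apply/fsubsetP => x /fsetDP[xF xt]; apply/fsetUP.
    case c : (x \in uncovered W F); [by left|right].
    apply: (fsubsetP (untiled_notin_core F tW)); rewrite in_fsetD xt.
    rewrite in_fset inE /= xF /=; apply/(mem_tile_ofxx _ qW).
    by move: c; rewrite in_fset inE /= xF /= => /negbFE/asboolP.
  apply: le_trans (card_fset_le _ sub) _.
  apply: le_trans (card_fsetU_le _ _ _) _.
  apply: le_trans (lerD (unc _ F1) F2) _; rewrite -mulrDl ler_wpM2r//.
  by lra.
Qed.

End Achievable.

(** * From averages to a point *)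

Section Balancing.
Variables (R : realType) (G : groupType) (Z : Type).
(* Phi l z g plays the role of the real or imaginary part of
   p_l (z_(h_(l,1) g), ...) - gamma l. *)
Variables (Phi : nat -> (G -> Z) -> G -> R) (H : nat -> {fset G}) (C : nat -> R).
Implicit Types (K F M T S A U : {fset G}) (x y g : G) (t : G -> {fset G}).

Hypothesis Phi_local : forall l z z' g,
  (forall k, k \in H l -> z (k * g)%g = z' (k * g)%g) -> Phi l z g = Phi l z' g.
Hypothesis Phi_bounded : forall l z g, `|Phi l z g| <= C l.
Hypothesis Phi_averages : forall A, A != fset0 -> forall L (delta : R), 0 < delta ->
  exists (K : nat) (z : 'I_K -> G -> Z), (0 < K)%N /\ forall l, (l < L)%N ->
    `|(K * #|` A|)%:R^-1 * \sum_(k < K) \sum_(g <- A) Phi l (z k) g| < delta.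

(* The weighted average over the patterns is small, so one of them is. *)
Lemma good_pattern A L (delta : R) (s : nat -> R) : A != fset0 -> 0 < delta ->
  exists w : G -> Z, \sum_(l < L) s l * (\sum_(g <- A) Phi l w g) <=
    delta * #|` A|%:R * \sum_(l < L) `|s l|.
Proof.
move=> A0 d0; have [K [z [K0 hz]]] := Phi_averages A0 L d0.
apply: contrapT => /forallNP nw.
have KA0 : 0 < (K * #|` A|)%:R :> R by rewrite ltr0n muln_gt0 K0 cardfs_gt0.
have : \sum_(k < K) (\sum_(l < L) s l * (\sum_(g <- A) Phi l (z k) g)) >
   \sum_(k < K) delta * #|` A|%:R * \sum_(l < L) `|s l|.
  have i0 : 'I_K by exists 0%N.
  rewrite (bigD1 i0)//= [X in _ < X](bigD1 i0)//=; apply: ltr_leD.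
    by rewrite ltNge; apply/negP; exact: nw.
  by apply: ler_sum => k _; rewrite leNgt; apply/negP => /ltW; exact: nw.
apply/negP; rewrite -leNgt exchange_big /=.
rewrite sumr_const card_ord -[leRHS]mulr_natl !mulrA mulr_sumr.
apply: ler_sum => l _; rewrite -mulr_sumr [leRHS]mulrC.
apply: le_trans (ler_norm _) _; rewrite normrM; apply: ler_wpM2l => //.
have := hz _ (ltn_ord l); rewrite normrM normfV (gtr0_norm KA0).
rewrite ltr_pdivrMl// => /ltW /le_trans; apply.
by rewrite natrM mulrAC.
Qed.

(* The pattern of a new tile is chosen so that its vector of sums has an almost
   nonpositive scalar product with the sum over the previous tiles. *)
Lemma balanced_patterns M t A L (delta b c : R) :
  is_tiling M t -> 0 < delta -> 0 <= b -> (forall l, (l < L)%N -> C l <= c) ->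
  {in A, forall x, x \in t x /\ (t x `<=` A)%fset} ->
  {in A, forall x, #|` t x|%:R <= b} ->
  exists w : {fset G} -> G -> Z,
    \sum_(l < L) (\sum_(g <- A) Phi l (w (t g)) g) ^+ 2 <=
    L%:R * (c ^+ 2 * b * #|` A|%:R + 2 * delta * c * #|` A|%:R ^+ 2).
Proof.
move=> tM d0 b0 cC; have [n] := ubnP #|` A|; elim: n A => // n IH A /ltnSE An At Ab.
have [A0|[x xA]] := fset_0Vmem A.
  (* [Z] is known to be inhabited only through [Phi_averages], here applied to a singleton. *)
  have A1 : [fset (1%g : G)]%fset != fset0 by apply/fset0Pn; exists 1%g; rewrite inE.
  have [K [z [K0 _]]] := Phi_averages A1 0 ltr01.
  exists (fun=> z (Ordinal K0)); rewrite A0 cardfs0 !mulr0 expr0n/= mulr0 addr0 mulr0.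
  by rewrite big1// => l _; rewrite big_seq_fset0 expr0n.
have [xt tA] := At x xA.
set B := (A `\` t x)%fset.
have BA : (B `<=` A)%fset by rewrite fsubsetDl.
have cA : #|` A|%:R = #|` t x|%:R + #|` B|%:R :> R.
  by rewrite -natrD -(cardfsID (t x) A) (fsetIidPr tA).
have tB y : y \in B -> t y != t x.
  rewrite inE => /andP[ytx yA]; have [yt _] := At y yA.
  by apply: contraNneq ytx => <-.
have [||y yB|w hw] := IH B.
- apply: leq_trans An; rewrite -(ltr_nat R) cA ltrDr ltr0n cardfs_gt0.
  by apply/fset0Pn; exists x.
- move=> y yB; have [yt tyA] := At y (fsubsetP BA _ yB); split => //.
  apply/fsubsetP => v vt; rewrite inE (fsubsetP tyA)// andbT.
  apply/negP => vtx; have [_ tv _] := tM _ _ vt; have [_ tv' _] := tM _ _ vtx.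
  by have := tB y yB; rewrite -tv tv' eqxx.
- by apply: Ab; exact: (fsubsetP BA).
have tx0 : t x != fset0 by apply/fset0Pn; exists x.
pose S l := \sum_(g <- B) Phi l (w (t g)) g.
have [w0 hw0] := good_pattern L S tx0 d0.
exists (fun T => if T == t x then w0 else w T).
pose V l := \sum_(g <- t x) Phi l w0 g.
have SV l : \sum_(g <- A) Phi l (if t g == t x then w0 else w (t g)) g = V l + S l.
  rewrite (sum_fsetD _ tA); congr (_ + _); rewrite big_seq [RHS]big_seq.
    by apply: eq_bigr => y yt; have [_ -> _] := tM _ _ yt; rewrite eqxx.
  by apply: eq_bigr => y /tB /negbTE ->.
(* A tile has at most [b] points, so the squares of the [V l] add up linearly in [#|A|]. The cross
   terms are what [good_pattern] bounds, and the products [#|t x| * #|B|] are absorbed by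
   [#|A| ^+ 2 - #|B| ^+ 2]. *)
under eq_bigr do rewrite SV sqrrD.
have Vb l : (l < L)%N -> `|V l| <= c * #|` t x|%:R.
  by move=> lL; apply: norm_sum_le => y _; apply: le_trans (cC _ lL).
have Sb l : (l < L)%N -> `|S l| <= c * #|` B|%:R.
  by move=> lL; apply: norm_sum_le => y _; apply: le_trans (cC _ lL).
rewrite 2!big_split /=.
have -> : \sum_(l < L) V l * S l *+ 2 = 2 * \sum_(l < L) S l * V l.
  by rewrite mulr_sumr; apply: eq_bigr => l _; rewrite -mulr_natl [S l * _]mulrC.
have V2 : \sum_(l < L) V l ^+ 2 <= L%:R * (c ^+ 2 * b * #|` t x|%:R).
  apply: (@le_trans _ _ (\sum_(l < L) (c ^+ 2 * b * #|` t x|%:R))).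
    apply: ler_sum => l _; rewrite -[V l ^+ 2]ger0_norm ?sqr_ge0//.
    have tb := Ab x xA; have c0 := le_trans (normr_ge0 _) (Vb l (ltn_ord l)).
    apply: (@le_trans _ _ ((c * #|` t x|%:R) ^+ 2)).
      by rewrite normrX lerXn2r ?nnegrE//; exact: Vb.
    rewrite exprMn -[c ^+ 2 * b * _]mulrA; apply: ler_wpM2l; first exact: sqr_ge0.
    by rewrite expr2; apply: ler_wpM2r.
  by rewrite sumr_const card_ord mulr_natl.
have S1 : \sum_(l < L) `|S l| <= L%:R * (c * #|` B|%:R).
  apply: (@le_trans _ _ (\sum_(l < L) (c * #|` B|%:R))).
    by apply: ler_sum => l _; exact: Sb.
  by rewrite sumr_const card_ord mulr_natl.
have h1 : delta * #|` t x|%:R * \sum_(l < L) `|S l| <=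
    delta * #|` t x|%:R * (L%:R * (c * #|` B|%:R)).
  by rewrite ler_wpM2l// mulr_ge0// ltW.
have c0 : (0 < L)%N -> 0 <= c.
  by move=> L0; apply: le_trans (cC 0%N L0); exact: le_trans (Phi_bounded 0 (fun=> w0 1%g) 1%g).
apply: le_trans (lerD (lerD V2 (ler_wpM2l _ (le_trans hw0 h1))) hw) _ => //.
rewrite -/B cA -subr_ge0; move: (ler0n R #|` t x|) (ler0n R #|` B|).
move: (#|` t x|%:R) (#|` B|%:R) => p q p0 q0.
rewrite (_ : _ - _ = L%:R * (2 * delta * c * (p * q + p ^+ 2))); last by ring.
case: posnP c0 => [->|L0 /(_ isT) c0]; first by rewrite mul0r.
by rewrite !mulr_ge0 ?addr_ge0 ?mulr_ge0 ?sqr_ge0// ltW.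
Qed.

Hypothesis amenable : forall K (eta : R), 0 < eta ->
  exists2 S : {fset G}, S != fset0 & invariant_under K eta S.
Hypothesis Ginfinite : infinite_set [set: G].

Lemma fset_union n (f : nat -> {fset G}) : exists U : {fset G}, forall x,
  x \in U <-> exists2 i, (i < n)%N & x \in f i.
Proof.
elim: n => [|n [U IH]]; first by exists fset0 => x; split => // -[].
exists (U `|` f n)%fset => x; split.
  case/fsetUP => [/IH[i ilt xi]|xn]; last by exists n.
  by exists i => //; exact: ltnW.
move=> [k]; rewrite ltnS leq_eqVlt => /orP[/eqP->|lt] xf; apply/fsetUP; [by right|].
by left; apply/IH; exists k.
Qed.

(** The core is nonempty and [F] contains [K x] for [x] in it, so any [K] with at least [n] elements
    will do. *)
Lemma invariant_large n : exists K, forall F, F != fset0 ->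
  invariant_under K (1/2 : R) F -> (n <= #|` F|)%N.
Proof.
have [K _ Kn] := infinite_set_fset n Ginfinite.
exists K => F F0 Finv; apply: leq_trans Kn _.
have [c0|[x /in_core[xF h]]] := fset_0Vmem (core K F).
  move: Finv; rewrite /invariant_under c0 fsetD0; have : 0 < #|` F|%:R :> R.
    by rewrite ltr0n cardfs_gt0.
  by lra.
rewrite -(card_rtranslate K x); apply: fsubset_leq_card.
by apply/fsubsetP => y; rewrite in_rtranslate => /h; rewrite mulgVK.
Qed.

(** [T] is almost filled by tiles of bounded size, to which [balanced_patterns] applies. All [z]
    extending the pattern must be allowed: sums over [T] also read the sequence outside [T], where
    gluing will put other patterns. *)
Lemma good_block L (delta : R) : 0 < delta ->
  exists K (eta : R), 0 < eta /\ forall T, T != fset0 -> invariant_under K eta T ->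
    exists w : G -> Z, forall z, {in T, forall g, z g = w g} ->
      forall l, (l < L)%N -> `|\sum_(g <- T) Phi l z g| <= delta * #|` T|%:R.
Proof.
move=> d0.
have [HL hHL] := fset_union L H.
pose c := 1 + \sum_(l < L) `|C l|.
have cge1 : 1 <= c by rewrite lerDl sumr_ge0.
have c0 : 0 < c by lra.
have cC l : (l < L)%N -> C l <= c.
  move=> lL; rewrite /c (bigD1 (Ordinal lL))//= addrCA.
  by apply: le_trans (ler_norm _) _; rewrite lerDl addr_ge0// sumr_ge0.
(* Error budget: [delta / 2] for the balanced sum, [2 * c * e] for points outside the core of their
   tile, [c * e] for untiled points. *)
pose e := delta / (8 * c).
have e0 : 0 < e by rewrite divr_gt0// mulr_gt0.
have ec : e * c = delta / 8 by rewrite /e; field; rewrite gt_eqF.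
have [t [M [K' [eta' [eta'0 tM tinv tcov]]]]] := tilings_exist amenable HL e0.
pose b : R := #|` M|%:R; have b0 : 0 <= b by exact: ler0n.
have L0 : 0 < L%:R + 1 :> R by rewrite ltr_wpDl.
(* [d'], and [n0] below, make each of the two terms of [balanced_patterns] at most
   [delta ^+ 2 / 8 * #|T| ^+ 2]. One of them is only linear in [#|A|], hence the lower bound [n0] on
   [#|T|]. *)
pose d' := delta ^+ 2 / (16 * (L%:R + 1) * c).
have d'0 : 0 < d' by rewrite divr_gt0 ?exprn_gt0// !mulr_gt0.
have d'c : 2 * L%:R * d' * c <= delta ^+ 2 / 8.
  rewrite (_ : _ * c = delta ^+ 2 / 8 * (L%:R / (L%:R + 1))); last first.
    by rewrite /d'; field; rewrite !gt_eqF.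
  rewrite ler_piMr ?divr_ge0 ?sqr_ge0//.
  by rewrite ler_pdivrMr// mul1r lerDl.
clearbody d' e c.
pose n0 := Num.bound (8 * (L%:R * c ^+ 2 * b) / delta ^+ 2).
have n0P : L%:R * c ^+ 2 * b <= delta ^+ 2 / 8 * n0%:R.
  have : 8 * (L%:R * c ^+ 2 * b) / delta ^+ 2 < n0%:R.
    rewrite /n0; apply: archi_boundP; apply: divr_ge0; last exact: sqr_ge0.
    by rewrite !mulr_ge0 ?(ltW c0) ?b0.
  rewrite ltr_pdivrMr ?exprn_gt0//; lra.
have [K3 K3n] := invariant_large n0.
exists (K' `|` K3)%fset, (Num.min (1/2) (Num.min eta' e)).
split; first by rewrite !lt_min eta'0 e0; lra.
move=> T T0 Tinv.
have T1 : invariant_under K' eta' T.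
  apply: invariant_underS Tinv; rewrite ?fsubsetUl//.
  by rewrite !ge_min lexx orbT.
have {K3n}K3n : (n0 <= #|` T|)%N.
  apply: K3n => //; apply: invariant_underS Tinv; rewrite ?fsubsetUr//.
  by rewrite ge_min lexx.
have {T1}Tcov := tcov T T1.
pose A := tiled t T.
have AT : (A `<=` T)%fset by exact: tiled_subset.
have At : {in A, forall x, x \in t x /\ (t x `<=` A)%fset}.
  move=> x xA; split; last exact: tile_tiled tM xA.
  by move: xA; rewrite in_tiled => /and3P[].
have Ab : {in A, forall x, #|` t x|%:R <= b}.
  move=> x /At [xt _]; rewrite /b -(card_rtranslate M x).
  apply: card_fset_le; apply/fsubsetP => y yt.
  by rewrite in_rtranslate; have [_ _] := tM _ _ yt.
have [w hw] := balanced_patterns tM d'0 (ler0n R _) cC At Ab.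
exists (fun g => w (t g) g) => z zT l lL.
pose a g := Phi l (w (t g)) g.
have p0 := ler0n R #|` T|.
have sa : `|\sum_(g <- A) a g| <= delta / 2 * #|` T|%:R.
  rewrite -(ler_pXn2r (_ : 0 < 2)%N)// ?nnegrE ?mulr_ge0 ?divr_ge0 ?(ltW d0)//.
  rewrite -normrX ger0_norm ?sqr_ge0//.
  apply: (@le_trans _ _ (L%:R * (c ^+ 2 * b * #|` A|%:R + 2 * d' * c * #|` A|%:R ^+ 2))).
    apply: le_trans hw; rewrite (bigD1 (Ordinal lL))//= lerDl sumr_ge0// => k _.
    exact: sqr_ge0.
  have cAT : #|` A|%:R <= #|` T|%:R :> R by exact: card_fset_le.
  have n0T : n0%:R <= #|` T|%:R :> R by rewrite ler_nat.
  have h1 : L%:R * c ^+ 2 * b * #|` A|%:R <= delta ^+ 2 / 8 * #|` T|%:R ^+ 2.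
    rewrite [#|` T|%:R ^+ 2]expr2 [leRHS]mulrA; apply: ler_pM => //; first by rewrite !mulr_ge0 ?(ltW c0) ?b0.
    by apply: le_trans n0P _; rewrite ler_wpM2l// divr_ge0 ?sqr_ge0.
  have h2 : (2 * L%:R * d' * c) * #|` A|%:R ^+ 2 <= delta ^+ 2 / 8 * #|` T|%:R ^+ 2.
    apply: ler_pM; [|by rewrite exprn_ge0|exact: d'c|by rewrite lerXn2r ?nnegrE].
    by rewrite !mulr_ge0 ?(ltW d'0) ?(ltW c0).
  rewrite exprMn expr_div_n (_ : 2 ^+ 2 = 4); last by ring.
  move: h1 h2; move: (#|` A|%:R) (#|` T|%:R) => q p h1 h2.
  by lra.
have cl0 : 0 <= C l by apply: le_trans (Phi_bounded l z 1%g).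
(* [z] follows the pattern of a tile only on that tile, so [Phi l z] and [a] agree on its [HL]-core
   and differ by at most [2 * c] elsewhere. *)
have sd : `|\sum_(g <- A) (Phi l z g - a g)| <= (2 * c * e) * #|` T|%:R.
  apply: (@le_trans _ _ ((2 * c * e) * #|` A|%:R)); last first.
    by rewrite ler_wpM2l ?card_fset_le// !mulr_ge0 ?ltW.
  apply: (closed_tile_sum tM At) => x xA.
  have [xt tA] := At x xA.
  rewrite (sum_fsetD _ (core_subset HL (t x))) [X in `|X + _|]big_seq.
  rewrite big1 ?add0r; last first.
    move=> y /in_core[yt hy]; apply/eqP; rewrite subr_eq0; apply/eqP.
    apply: Phi_local => k kH; have kHL : k \in HL by apply/hHL; exists l.
    have kyt := hy k kHL; have [_ tky _] := tM _ _ kyt; have [_ ty _] := tM _ _ yt.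
    by rewrite zT ?tky ?ty// (fsubsetP AT)// (fsubsetP tA).
  have := tinv x xt; rewrite /invariant_under => h.
  have c2 : 0 <= 2 * c by rewrite mulr_ge0// ltW.
  rewrite -(mulrA (2 * c)); apply: le_trans (ler_wpM2l c2 h).
  apply: norm_sum_le => y _; apply: le_trans (ler_normB _ _) _.
  by rewrite mulrDl mul1r lerD// (le_trans (Phi_bounded _ _ _))// cC.
have sr : `|\sum_(g <- (T `\` A)%fset) Phi l z g| <= c * e * #|` T|%:R.
  rewrite -mulrA; apply: le_trans (ler_wpM2l (ltW c0) Tcov).
  by apply: norm_sum_le => y _; rewrite (le_trans (Phi_bounded _ _ _))// cC.
rewrite (sum_fsetD _ AT) (_ : \sum_(y <- A) _ = \sum_(g <- A) a g +
   \sum_(g <- A) (Phi l z g - a g)); last first.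
  by rewrite -big_split /=; apply: eq_bigr => y _; rewrite addrC subrK.
apply: le_trans (ler_normD _ _) _; apply: le_trans (lerD (ler_normD _ _) sr) _.
apply: le_trans (lerD (lerD sa sd) (lexx _)) _.
have -> : 2 * c * e = delta / 4 by move: ec; lra.
have -> : c * e = delta / 8 by move: ec; lra.
by move: (mulr_ge0 (ltW d0) p0); lra.
Qed.
End Balancing.

(** * Gluing tilings of increasing precision *)

Section Gluing.
Variables (R : realType) (G : groupType) (Z : Type).
Variables (Phi : nat -> (G -> Z) -> G -> R) (H : nat -> {fset G}) (C : nat -> R).
Implicit Types (K M T S A U : {fset G}) (x y g : G) (t : G -> {fset G}).

Hypothesis Phi_local : forall l z z' g,
  (forall k, k \in H l -> z (k * g)%g = z' (k * g)%g) -> Phi l z g = Phi l z' g.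
Hypothesis Phi_bounded : forall l z g, `|Phi l z g| <= C l.
Hypothesis Phi_averages : forall A, A != fset0 -> forall L (delta : R), 0 < delta ->
  exists (K : nat) (z : 'I_K -> G -> Z), (0 < K)%N /\ forall l, (l < L)%N ->
    `|(K * #|` A|)%:R^-1 * \sum_(k < K) \sum_(g <- A) Phi l (z k) g| < delta.
Variable F : nat -> {fset G}.
Hypothesis Ginfinite : infinite_set [set: G].
Hypothesis FFolner : left_Folner R F.

Definition scale_prec (s : nat) : R := s.+1%:R^-1.

Lemma scale_prec_gt0 s : 0 < scale_prec s. Proof. by rewrite invr_gt0. Qed.

Lemma scale_prec_le s s' : (s <= s')%N -> scale_prec s' <= scale_prec s.
Proof. by move=> ss'; rewrite lef_pV2 ?posrE// ler_nat ltnS. Qed.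

Lemma Folner_amenable K (eta : R) : 0 < eta ->
  exists2 S : {fset G}, S != fset0 & invariant_under K eta S.
Proof.
move=> /(Folner_invariant FFolner K) [N hN]; exists (F N); last exact: hN.
by have [] := FFolner.
Qed.

(** [sd_test] and [sd_tol] are the invariance under which a finite set is well covered by the tiles
    of this scale; [sd_pat] assigns a pattern to each tile. *)
Record scale_data := ScaleData {
  sd_tile : G -> {fset G}; sd_bound : {fset G};
  sd_test : {fset G}; sd_tol : R;
  sd_pat : {fset G} -> G -> Z }.

Definition good_tile s (w : G -> Z) T := forall z, {in T, forall g, z g = w g} ->
  forall l, (l < s)%N -> `|\sum_(g <- T) Phi l z g| <= scale_prec s * #|` T|%:R.

(** The third clause lets a tile of one scale be broken up into tiles of the preceding one, as is
    needed where the scales meet. *)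
Definition scale_ok s (prev next : scale_data) := [/\ 0 < sd_tol next,
  is_tiling (sd_bound next) (sd_tile next),
  forall x, x \in sd_tile next x ->
    invariant_under (sd_test prev) (sd_tol prev) (sd_tile next x),
  forall x, x \in sd_tile next x ->
    good_tile s (sd_pat next (sd_tile next x)) (sd_tile next x) &
  forall A, invariant_under (sd_test next) (sd_tol next) A ->
    #|` (A `\` tiled (sd_tile next) A)%fset|%:R <= scale_prec s * #|` A|%:R].

Lemma pattern_default : exists w : G -> Z, True.
Proof.
have A1 : [fset (1%g : G)]%fset != fset0 by apply/fset0Pn; exists 1%g; rewrite inE.
by have [K [z [K0 _]]] := Phi_averages A1 0 ltr01; exists (z (Ordinal K0)).
Qed.

(** The condition on [prev] stands under the existential so that [choice] yields a total function,
    ready for recursion. *)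
Lemma next_scale s prev : exists next, 0 < sd_tol prev -> scale_ok s prev next.
Proof.
have [e0|] := ltP 0 (sd_tol prev); last by exists prev.
have [K2 [e2 [e20 good]]] :=
  good_block Phi_local Phi_bounded Phi_averages Folner_amenable Ginfinite s
    (scale_prec_gt0 s).
pose K := (sd_test prev `|` K2)%fset.
pose e := Num.min (scale_prec s) (Num.min (sd_tol prev) e2).
have e'0 : 0 < e by rewrite !lt_min scale_prec_gt0 e0.
have [t [M [K' [e' [e'0' tM tinv tcov]]]]] := tilings_exist Folner_amenable K e'0.
have [w0 _] := pattern_default.
have /choice [pat hpat] : forall T, exists w : G -> Z, T != fset0 ->
    invariant_under K2 e2 T -> good_tile s w T.
  move=> T; have [[T0 Ti]|nT] := pselect (T != fset0 /\ invariant_under K2 e2 T).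
    by have [w hw] := good T T0 Ti; exists w.
  by exists w0 => T0 Ti; case: nT.
exists (ScaleData t M K' e' pat) => _; split => //=.
- move=> x /tinv; apply: invariant_underS; rewrite ?fsubsetUl//.
  by rewrite !ge_min lexx orbT.
- move=> x xt; apply: hpat; first by apply/fset0Pn; exists x.
  apply: invariant_underS (tinv x xt); rewrite ?fsubsetUr//.
  by rewrite !ge_min lexx !orbT.
- move=> A /tcov /le_trans; apply; rewrite ler_wpM2r// ge_min lexx.
  by [].
Qed.

Lemma scales_exist : exists sd : nat -> scale_data,
  (forall s, scale_ok s.+1 (sd s) (sd s.+1)) /\
  exists prev, scale_ok 0 prev (sd 0%N).
Proof.
have [w0 _] := pattern_default.
have /choice [f hf] : forall p : nat * scale_data, exists next,
  0 < sd_tol p.2 -> scale_ok p.1 p.2 next by move=> [s prev]; exact: next_scale.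
(* A fictitious scale before the first: with an empty test set, every finite set passes its
   invariance test. *)
pose d0 := ScaleData (fun=> fset0) fset0 fset0 1 (fun=> w0).
pose sd := fix sd s := if s is s'.+1 then f (s, sd s') else f (0%N, d0).
have ok0 : scale_ok 0 d0 (sd 0%N) by exact: (hf (0%N, d0)).
have tol s : 0 < sd_tol (sd s).
  elim: s => [|s IH]; first by case: ok0.
  by have [] := hf (s.+1, sd s) IH.
by exists sd; split; [move=> s; exact: (hf (s.+1, sd s) (tol s))|exists d0].
Qed.

Lemma fset_union_mono (U : nat -> {fset G}) n m :
  (forall n x, x \in U n <-> exists2 i, (i < n)%N & x \in F i) ->
  (n <= m)%N -> (U n `<=` U m)%fset.
Proof.
move=> hU nm; apply/fsubsetP => x /hU[k kn xk]; apply/hU.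
by exists k => //; exact: leq_trans nm.
Qed.

Lemma card_Folner_large (n : nat) (e : R) : 0 < e ->
  exists N0, forall N, (N0 <= N)%N -> n%:R <= e * #|` F N|%:R.
Proof.
move=> e0; have [K hK] := invariant_large R Ginfinite (Num.bound (n%:R / e)).
have h2 : 0 < 1/2 :> R by lra.
have [N0 hN] := Folner_invariant FFolner K h2; exists N0 => N /hN /hK h.
have h' : (Num.bound (n%:R / e))%:R <= #|` F N|%:R :> R.
  by rewrite ler_nat; apply: h; have [] := FFolner.
rewrite mulrC -ler_pdivrMr//; apply: le_trans h'; apply: ltW.
by apply: archi_boundP; rewrite divr_ge0// ltW.
Qed.

(** [tau s.+1] is chosen once [tau s] is known: the neighbourhood of [U (tau s)] is then a fixed
    finite set, negligible in all late [F N] since their sizes tend to infinity. *)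
Lemma thresholds_exist (sd : nat -> scale_data) (U : nat -> {fset G}) :
  (forall s, 0 < sd_tol (sd s)) ->
  exists tau : nat -> nat, [/\ forall s, (tau s < tau s.+1)%N,
    forall s N, (tau s.+1 <= N)%N ->
      invariant_under (sd_test (sd s.+1)) (sd_tol (sd s.+1)) (F N) &
    forall s N, (tau s.+1 <= N)%N ->
      #|` [fset (m * y)%g | m in sd_bound (sd s), y in U (tau s)]%fset|%:R <=
      scale_prec s * #|` F N|%:R].
Proof.
move=> tol.
have /choice [f hf] : forall p : nat * nat, exists n', [/\ (p.2 < n')%N,
  forall N, (n' <= N)%N ->
      invariant_under (sd_test (sd p.1.+1)) (sd_tol (sd p.1.+1)) (F N) &
  forall N, (n' <= N)%N ->
      #|` [fset (m * y)%g | m in sd_bound (sd p.1), y in U p.2]%fset|%:R <=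
      scale_prec p.1 * #|` F N|%:R].
  move=> [s n] /=.
  have [N1 h1] := Folner_invariant FFolner (sd_test (sd s.+1)) (tol s.+1).
  have [N2 h2] := card_Folner_large
     #|` [fset (m * y)%g | m in sd_bound (sd s), y in U n]%fset| (scale_prec_gt0 s).
  exists (maxn n.+1 (maxn N1 N2)); split; first by rewrite leq_maxl.
    by move=> N; rewrite !geq_max => /and3P[_ + _]; exact: h1.
  by move=> N; rewrite !geq_max => /and3P[_ _ +]; exact: h2.
pose tau := fix tau s := if s is s'.+1 then f (s', tau s') else 0%N.
by exists tau; split => s; have [] := hf (s, tau s).
Qed.

Section Kept.
Variables (sd : nat -> scale_data) (tau : nat -> nat) (U : nat -> {fset G}).
Hypothesis UP : forall n x, x \in U n <-> exists2 i, (i < n)%N & x \in F i.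
Hypothesis sd_ok : forall s, scale_ok s.+1 (sd s) (sd s.+1).
Hypothesis sd_ok0 : exists prev, scale_ok 0 prev (sd 0%N).
Hypothesis tau_lt : forall s, (tau s < tau s.+1)%N.
Hypothesis tau_inv : forall s N, (tau s.+1 <= N)%N ->
  invariant_under (sd_test (sd s.+1)) (sd_tol (sd s.+1)) (F N).
Hypothesis tau_large : forall s N, (tau s.+1 <= N)%N ->
  #|` [fset (m * y)%g | m in sd_bound (sd s), y in U (tau s)]%fset|%:R <=
  scale_prec s * #|` F N|%:R.

Let t s := sd_tile (sd s).
Let E s := U (tau s).

Lemma scale_tiling s : is_tiling (sd_bound (sd s)) (t s).
Proof. by case: s => [|s]; [have [p []] := sd_ok0|have [] := sd_ok s]. Qed.

Lemma scale_good s x : x \in t s x -> good_tile s (sd_pat (sd s) (t s x)) (t s x).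
Proof.
by case: s => [|s]; [have [p [_ _ _ h _]] := sd_ok0|have [_ _ _ h _] := sd_ok s]; exact: h.
Qed.

Lemma scale_cover s A : invariant_under (sd_test (sd s)) (sd_tol (sd s)) A ->
  #|` (A `\` tiled (t s) A)%fset|%:R <= scale_prec s * #|` A|%:R.
Proof.
by case: s => [|s]; [have [p [_ _ _ _ h]] := sd_ok0|have [_ _ _ _ h] := sd_ok s]; exact: h.
Qed.

Lemma E_mono s s' : (s <= s')%N -> (E s `<=` E s')%fset.
Proof.
move=> ss'; apply: fset_union_mono UP _.
elim: s' ss' => [|s' IH]; first by rewrite leqn0 => /eqP->.
rewrite leq_eqVlt => /orP[/eqP->//|/IH h]; exact: leq_trans h (ltnW _).
Qed.

(** [E s] is the union of the [F i] with [i < tau s]. Tiles of scale [s] that meet it are rejected,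
    which leaves this region to smaller scales; where unrejected tiles of several scales overlap,
    the larger scale has priority. *)
Definition meets T s := exists2 y, y \in T & y \in E s.

(* Kept tiles of all scales are disjoint.  For tau s.+1 <= N < tau s.+2, F N lies
   in E s.+2, and outside a bounded neighbourhood of E s it only meets kept tiles
   of the scales s and s.+1. *)
Definition kept s x := [/\ x \in t s x, ~ meets (t s x) s &
  forall s' y, (s < s')%N -> y \in t s x -> y \in t s' y -> meets (t s' y) s'].

Lemma kept_uniq s s' x : kept s x -> kept s' x -> s = s'.
Proof.
move=> [xs ns hs] [xs' ns' hs']; case: (ltngtP s s') => // ss'; exfalso.
  exact/ns'/(hs s' x).
exact/ns/(hs' s x).
Qed.

Lemma kept_tile s x y : kept s x -> y \in t s x -> kept s y.
Proof.
move=> [xs ns hs] yt; have [_ ty _] := scale_tiling yt.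
by split; rewrite ty//; exact: hs.
Qed.

Definition glued (w0 : G -> Z) x : Z :=
  if pselect (exists s, kept s x) is left e then
    let s := sval (cid e) in sd_pat (sd s) (t s x) x
  else w0 x.

Lemma gluedE w0 s x : kept s x -> glued w0 x = sd_pat (sd s) (t s x) x.
Proof.
move=> kx; rewrite /glued; case: pselect => [e|[]]; last by exists s.
by case: cid => s' /= kx'; rewrite (kept_uniq kx' kx).
Qed.

Lemma kept_sum w0 s x l : kept s x -> (l < s)%N ->
  `|\sum_(g <- t s x) Phi l (glued w0) g| <= scale_prec s * #|` t s x|%:R.
Proof.
move=> kx; have [xs _ _] := kx; apply: (scale_good xs) => y yt.
have [_ ty _] := scale_tiling yt.
by rewrite (gluedE _ (kept_tile kx yt)) ty.
Qed.

(** Tile [F N] at scale [s.+1]. An unrejected tile is kept, because [F N] lies in [E s'] for all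
    larger [s']. A rejected one is tiled again at scale [s], where the tiles avoiding [E s] are
    kept. The three terms [C l] come from points untiled at scale [s.+1], points untiled at scale
    [s], and points near [E s]. *)
Lemma glued_Folner_sum w0 l s N : (l < s)%N ->
  (tau s.+1 <= N < tau s.+2)%N ->
  `|\sum_(g <- F N) Phi l (glued w0) g| <=
    (1 + 3 * C l) * scale_prec s * #|` F N|%:R.
Proof.
move=> ls /andP[N1 N2].
set z := glued w0.
have C0 : 0 <= C l := le_trans (normr_ge0 _) (Phi_bounded l z 1%g).
have FE s' : (s.+1 < s')%N -> (F N `<=` E s')%fset.
  move=> ss'; apply: fsubset_trans (E_mono ss').
  by apply/fsubsetP => x xF; apply/UP; exists N.
(* Both tiles of a bad point are rejected. Inside a tile of scale [s.+1], badness is constant on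
   each tile of scale [s], so [a] is there either zero or equal to [Phi l z]. *)
pose bad x := `[< meets (t s x) s /\ meets (t s.+1 x) s.+1 >].
pose a x := if bad x then 0 else Phi l z x.
have aC x : `|a x| <= C l by rewrite /a; case: ifP => // _; rewrite normr0.
have p0 := scale_prec_gt0 s; have p0' := scale_prec_gt0 s.+1.
have p1 := scale_prec_le (leqnSn s).
have sum_a : `|\sum_(g <- F N) a g| <=
    (scale_prec s + C l * scale_prec s + C l * scale_prec s.+1) * #|` F N|%:R.
  apply: (tilewise_sum (scale_tiling (s := s.+1))) => //.
  - by rewrite addr_ge0 ?mulr_ge0 ?(ltW p0).
  - exact: scale_cover (tau_inv N1).
  move=> x xt tF; set T := t s.+1 x in xt tF *.
  have [mT|nT] := pselect (meets T s.+1); last first.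
    have kx : kept s.+1 x.
      split=> // s' y ss' yt yt'; exists y => //.
      by apply: (fsubsetP (FE _ ss')); exact: (fsubsetP tF).
    rewrite (eq_big_seq (Phi l z)) => [|y yt].
      apply: le_trans (kept_sum w0 kx _) _; first exact: ltnW.
      by rewrite ler_wpM2r//; have := mulr_ge0 C0 (ltW p0); lra.
    rewrite /a; case: ifP => // /asboolP[_].
    by have [_ -> _] := scale_tiling yt.
  have Tcov : #|` (T `\` tiled (t s) T)%fset|%:R <= scale_prec s * #|` T|%:R.
    by apply: scale_cover; have [_ _ h _ _] := sd_ok s; exact: h.
  apply: (tilewise_sum (scale_tiling (s := s))) Tcov _ => //; first exact: ltW.
  move=> y yt BT; set B := t s y in yt BT *.
  have [mB|nB] := pselect (meets B s).
    rewrite big_seq big1 ?normr0 ?mulr_ge0 ?(ltW p0)// => v vB.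
    rewrite /a; case: ifP => // /asboolPn; case.
    have [_ -> _] := scale_tiling vB.
    by have [_ -> _] := scale_tiling (fsubsetP BT _ vB).
  have ky : kept s y.
    split=> // s' v ss' vB vt'; have vT := fsubsetP BT _ vB.
    case: (ltngtP s.+1 s') ss' => [ss' _|/ltnSE|<- _].
    - by exists v => //; apply: (fsubsetP (FE _ ss')); exact: (fsubsetP tF).
    - by [].
    - by have [_ -> _] := scale_tiling vT.
  rewrite (eq_big_seq (Phi l z)) => [|v vt]; first exact: kept_sum.
  rewrite /a; case: ifP => // /asboolP[+ _].
  by have [_ -> _] := scale_tiling vt.
(* The tile of a bad point meets [E s], so the point is within [sd_bound (sd s)] of [U (tau s)]. *)
have sub : ([fset x in F N | bad x] `<=`
    [fset (m * y)%g | m in sd_bound (sd s), y in U (tau s)])%fset.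
  apply/fsubsetP => y; rewrite in_fset inE => /andP[_ /asboolP[[v vB vE] _]].
  have [yy ty _] := scale_tiling vB.
  have [|_ _ yv] := @scale_tiling s v y; first by rewrite ty.
  apply/imfset2P; exists (y * v^-1)%g => //.
  by exists v => //; rewrite mulgVK.
have sum_d :
  `|\sum_(g <- F N) (Phi l z g - a g)| <= C l * (scale_prec s * #|` F N|%:R).
  rewrite (big_fsetID _ bad)/= [X in `|_ + X|]big_seq [X in `|_ + X|]big1 ?addr0; last first.
    by move=> y; rewrite !inE /= => /andP[_ /negbTE by_]; rewrite /a by_ subrr.
  apply: le_trans (ler_wpM2l C0 (tau_large N1)).
  apply: le_trans (ler_wpM2l C0 (card_fset_le _ sub)).
  apply: norm_sum_le => y; rewrite !inE /= => /andP[_ by_].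
  by rewrite /a by_ subr0.
rewrite (eq_bigr (fun g => a g + (Phi l z g - a g))) => [|g _]; last first.
  by rewrite addrC subrK.
rewrite big_split /=; apply: le_trans (ler_normD _ _) _.
apply: le_trans (lerD sum_a sum_d) _; rewrite mulrA -mulrDl ler_wpM2r//.
by have := ler_wpM2l C0 p1; lra.
Qed.

End Kept.

Theorem generic_point : exists z : G -> Z, forall l (e : R), 0 < e ->
  exists N0, forall N, (N0 <= N)%N ->
    `|\sum_(g <- F N) Phi l z g| <= e * #|` F N|%:R.
Proof.
have [sd [ok ok0]] := scales_exist.
have tol s : 0 < sd_tol (sd s).
  by case: s => [|s]; [have [p []] := ok0|have [] := ok s].
have /choice [U UP] : forall n, exists A : {fset G}, forall x,
    x \in A <-> exists2 k, (k < n)%N & x \in F k by move=> n; exact: fset_union.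
have [tau [tau_lt tau_inv tau_large]] := thresholds_exist U tol.
have [w0 _] := pattern_default.
exists (glued sd tau U w0) => l e e0.
have C0 : 0 <= C l := le_trans (normr_ge0 _) (Phi_bounded l w0 1%g).
have c0 : 0 < 1 + 3 * C l by lra.
(* The first bound gives [l < s], the second makes [(1 + 3 * C l) * scale_prec s] at most [e]. *)
pose s0 := (maxn l.+1 (Num.bound ((1 + 3 * C l) / e))).
have tau_ge s : (s <= tau s)%N.
  by elim: s => // s IH; exact: leq_ltn_trans IH (tau_lt s).
exists (tau s0.+1) => N N0.
have ex : exists s, (tau s.+1 <= N)%N by exists s0.
have ub s : (tau s.+1 <= N)%N -> (s <= N)%N.
  by move=> h; apply: leq_trans h; apply: leq_trans (tau_ge _).
case: (ex_maxnP ex ub) => s sN smax.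
have ss0 := smax _ N0.
have ls : (l < s)%N by apply: leq_trans ss0; rewrite leq_maxl.
apply: le_trans (glued_Folner_sum UP ok ok0 tau_lt tau_inv tau_large w0 ls _) _.
  by rewrite sN ltnNge; apply/negP => /smax; rewrite ltnn.
rewrite ler_wpM2r// /scale_prec ler_pdivrMr// -ler_pdivrMl//.
rewrite mulrC; apply: (@le_trans _ _ (Num.bound ((1 + 3 * C l) / e))%:R).
  by apply: ltW; apply: archi_boundP; rewrite divr_ge0 ?ltW.
by rewrite ler_nat; apply: leqW; apply: leq_trans ss0; rewrite leq_maxr.
Qed.

End Gluing.

(** * Bounded functions on a probability space *)

Section BoundedIntegral.
Variables (R : realType) (d : measure_display) (X : measurableType d).
Variable P : probability X R.
Implicit Types f g : X -> R.

Lemma bounded_integrable f c : measurable_fun setT f -> (forall x, `|f x| <= c) ->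
  P.-integrable setT (EFin \o f).
Proof.
move=> mf fc; apply: measurable_bounded_integrable => //.
  by apply: le_lt_trans (probability_le1 P measurableT) (ltry _).
exists c; split; first exact: num_real.
by move=> M cM x _; apply: le_trans (fc x) (ltW cM).
Qed.

Lemma Rintegral_le_bound f c : measurable_fun setT f -> (forall x, `|f x| <= c) ->
  `|\int[P]_x f x| <= c.
Proof.
move=> mf fc; have fi := bounded_integrable mf fc.
have ci a : P.-integrable setT (EFin \o (fun _ : X => a)).
  by apply: (@bounded_integrable _ `|a|).
have ce a : \int[P]_x a = a.
  by rewrite Rintegral_cst//= probability_setT mulr1.
have lo : \int[P]_x (- c) <= \int[P]_x f x.
  by apply: le_Rintegral => // x _; have := fc x; rewrite ler_norml => /andP[].
have hi : \int[P]_x f x <= \int[P]_x c.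
  by apply: le_Rintegral => // x _; have := fc x; rewrite ler_norml => /andP[].
by move: lo hi; rewrite !ce ler_norml => -> ->.
Qed.

Lemma Rintegral_dist f g c e : measurable_fun setT f -> measurable_fun setT g ->
  (forall x, `|g x| <= c) ->
  (forall x, `|f x - g x| <= e) -> `|\int[P]_x f x - \int[P]_x g x| <= e.
Proof.
move=> mf mg gc fg.
have fc x : `|f x| <= e + c.
  by rewrite -(subrK (g x) (f x)); apply: le_trans (ler_normD _ _) (lerD _ _).
rewrite -RintegralB//; [|exact: bounded_integrable fc|exact: bounded_integrable gc].
by apply: Rintegral_le_bound => //; exact: measurable_funB.
Qed.

Lemma Rintegral_lincomb (I : Type) (r : seq I) (a : I -> R) (f : I -> X -> R)
    (c : I -> R) :
  (forall k, measurable_fun setT (f k)) -> (forall k x, `|f k x| <= c k) ->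
  [/\ measurable_fun setT (fun x => \sum_(k <- r) a k * f k x),
      forall x, `|\sum_(k <- r) a k * f k x| <= \sum_(k <- r) `|a k| * c k &
      \int[P]_x (\sum_(k <- r) a k * f k x) = \sum_(k <- r) a k * \int[P]_x f k x].
Proof.
move=> mf fc; elim: r => [|k r [mS bS iS]].
  split.
  - by under eq_fun do rewrite big_nil; exact: measurable_cst.
  - by move=> x; rewrite !big_nil normr0.
  - under eq_Rintegral do rewrite big_nil.
    by rewrite big_nil Rintegral_cst// mul0r.
have mk : measurable_fun setT (fun x => a k * f k x) by exact: measurable_funM.
have bk x : `|a k * f k x| <= `|a k| * c k by rewrite normrM ler_wpM2l.
split.
- by under eq_fun do rewrite big_cons; exact: measurable_funD.
- by move=> x; rewrite !big_cons; apply: le_trans (ler_normD _ _) (lerD _ _).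
under eq_Rintegral do rewrite big_cons.
rewrite RintegralD//; [|exact: bounded_integrable bk|exact: bounded_integrable bS].
by rewrite big_cons iS RintegralZl//; exact: bounded_integrable (fc k).
Qed.

End BoundedIntegral.

(** * Greedy choice of finitely many points *)

Section Greedy.
Variables (R : realType) (X : Type) (L : nat) (u : nat -> X -> R) (c : R).
Hypothesis u_bounded : forall l x, (l < L)%N -> `|u l x| <= c.
Hypothesis u_cancel : forall s : nat -> R, exists x, \sum_(l < L) s l * u l x <= 1.

Lemma greedy_seq n : exists xs : seq X, size xs = n /\
  \sum_(l < L) (\sum_(x <- xs) u l x) ^+ 2 <= n%:R * (L%:R * c ^+ 2 + 2).
Proof.
elim: n => [|n [xs [sxs hxs]]].
  exists [::]; split => //; rewrite mul0r big1// => l _; rewrite big_nil expr0n//.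
(* Weighted by the current sums, the new point makes the cross term at most 2, so the squared norm
   grows by at most [L * c ^+ 2 + 2]. *)
have [x hx] := u_cancel (fun l => \sum_(x <- xs) u l x).
exists (x :: xs); split; first by rewrite /= sxs.
under eq_bigr do rewrite big_cons sqrrD.
rewrite 2!big_split /=.
have h1 : \sum_(l < L) u l x ^+ 2 <= L%:R * c ^+ 2.
  apply: (@le_trans _ _ (\sum_(l < L) c ^+ 2)).
    apply: ler_sum => l _; rewrite -[u l x ^+ 2]ger0_norm ?sqr_ge0// normrX.
    have ux := u_bounded x (ltn_ord l).
    by rewrite lerXn2r ?nnegrE // (le_trans _ ux).
  by rewrite sumr_const card_ord mulr_natl.
have h2 : \sum_(l < L) u l x * (\sum_(y <- xs) u l y) *+ 2 <= 2.
  rewrite sumrMnl -[leLHS]mulr_natl ler_piMr//.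
  by apply: le_trans hx; apply: ler_sum => l _; rewrite mulrC.
rewrite -[X in X%:R * _]addn1 natrD mulrDl mul1r addrC.
by apply: lerD => //; exact: lerD.
Qed.

Lemma greedy_average (delta : R) : 0 < delta ->
  exists (K : nat) (x : 'I_K -> X), (0 < K)%N /\ forall l, (l < L)%N ->
    `|\sum_(k < K) u l (x k)| < delta * K%:R.
Proof.
move=> d0; pose B := L%:R * c ^+ 2 + 2.
have B0 : 0 < B by rewrite ltr_wpDl // mulr_ge0 // sqr_ge0.
pose K := (Num.bound (B / delta ^+ 2)).
have KP : B < delta ^+ 2 * K%:R.
  rewrite mulrC -ltr_pdivrMr ?exprn_gt0//; apply: archi_boundP.
  by rewrite divr_ge0 ?sqr_ge0// ltW.
have K0 : (0 < K)%N.
  by rewrite -(ltr_nat R) -(pmulr_rgt0 _ (exprn_gt0 2 d0)); apply: lt_trans KP.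
have [xs [sxs hxs]] := greedy_seq K.
exists K, (tnth (Tuple (introT eqP sxs))); split => // l lL.
rewrite -(big_tuple _ _ (Tuple (introT eqP sxs)) xpredT (u l)) /=.
rewrite -(ltr_pXn2r (_ : 0 < 2)%N)// ?nnegrE// ?mulr_ge0 ?(ltW d0)//.
rewrite -normrX ger0_norm ?sqr_ge0//.
apply: (@le_lt_trans _ _ (K%:R * B)).
  apply: le_trans hxs; rewrite (bigD1 (Ordinal lL))//= lerDl sumr_ge0// => k _.
  exact: sqr_ge0.
by rewrite exprMn [K%:R ^+ 2]expr2 mulrA mulrC ltr_pM2r// ltr0n.
Qed.

End Greedy.

(** * The Loeb space of an ultrafilter *)

Lemma ultra_fmap (S T : Type) (f : S -> T) (U : set_system S) :
  UltraFilter U -> UltraFilter (f @ U).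
Proof.
move=> UU; constructor; first exact: fmap_proper_filter.
move=> H PH sub; apply/seteqP; split => // A HA.
have [//|UnA] := in_ultra_setVsetC (f @^-1` A) UU.
have HnA : H (~` A) by exact: sub.
have := @filterI _ H _ _ _ HA HnA; rewrite setICr => H0.
by exfalso; exact: (@filter_not_empty _ H PH (H0 _)).
Qed.

Section UltraMean.
Variables (R : realType) (G : groupType) (F : nat -> {fset G}).
Variables (U : set_system nat) (UU : UltraFilter U).
Hypothesis FFolner : left_Folner R F.
Hypothesis Uoo : \oo `<=` U.
Implicit Types (psi phi : G -> R).

Definition average psi (N : nat) : R := #|` F N|%:R^-1 * \sum_(g <- F N) psi g.

Definition umean psi : R := lim (average psi @ U).

Let cardF N : 0 < #|` F N|%:R :> R.
Proof. by rewrite ltr0n cardfs_gt0; have [] := FFolner. Qed.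

Lemma average_bounded psi c N : (forall g, `|psi g| <= c) -> `|average psi N| <= c.
Proof.
move=> hc; rewrite normrM normfV (gtr0_norm (cardF N)) ler_pdivrMl//.
apply: le_trans (ler_norm_sum _ _ _) _; apply: (@le_trans _ _ (\sum_(g <- F N) c)).
  by apply: ler_sum => g _; exact: hc.
by rewrite big_const_seq count_predT iter_addr_0 mulr_natl.
Qed.

Lemma bounded_ucvg (u : nat -> R) c : (forall N, `|u N| <= c) ->
  exists l : R, u @ U --> l.
Proof.
move=> uc; have := @segment_compact R (- c) c; rewrite compact_ultra.
move=> /(_ _ (ultra_fmap u UU)) [|l [_ ul]]; last by exists l.
  apply: (@filterE _ U) => N; rewrite /= in_itv /= -ler_norml; exact: uc.
Qed.

Lemma umean_cvg psi c : (forall g, `|psi g| <= c) -> average psi @ U --> umean psi.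
Proof.
move=> hc; have [l hl] := bounded_ucvg (fun N => average_bounded N hc).
by rewrite /umean (cvg_lim _ hl)//; exact: Rhausdorff.
Qed.

Lemma umean_eq psi l : average psi @ U --> l -> umean psi = l.
Proof. by move=> h; rewrite /umean (cvg_lim _ h)//; exact: Rhausdorff. Qed.

Lemma umean_cvg_eq psi l : average psi @ \oo --> l -> umean psi = l.
Proof. by move=> h; apply: umean_eq; apply: cvg_trans h; exact: cvg_app. Qed.

Lemma umeanD psi phi c c' : (forall g, `|psi g| <= c) -> (forall g, `|phi g| <= c') ->
  umean (fun g => psi g + phi g) = umean psi + umean phi.
Proof.
move=> /umean_cvg h /umean_cvg h'; apply: umean_eq.
rewrite (_ : average _ = average psi \+ average phi); first exact: cvgD.
by apply/funext => N; rewrite /average /= big_split mulrDr.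
Qed.

Lemma umeanZ psi c a : (forall g, `|psi g| <= c) ->
  umean (fun g => a * psi g) = a * umean psi.
Proof.
move=> /umean_cvg h; apply: umean_eq.
rewrite (_ : average _ = (fun N => a * average psi N)); first exact: cvgMr.
by apply/funext => N; rewrite /average -mulr_sumr mulrCA.
Qed.

Lemma umean_cst a : umean (fun=> a) = a.
Proof.
apply: umean_eq; rewrite (_ : average _ = cst a); first exact: cvg_cst.
apply/funext => N; rewrite /average big_const_seq count_predT iter_addr_0 /=.
by rewrite -[a *+ _]mulr_natl mulKf// gt_eqF.
Qed.

Lemma umean_bounded psi c : (forall g, `|psi g| <= c) -> `|umean psi| <= c.
Proof.
move=> hc; have /cvg_norm h := umean_cvg hc.
apply: (@closed_cvg _ _ U _ (fun N => `|average psi N|) (fun x => x <= c) _ _ _ h).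
  exact: closed_le.
by apply: filterE => N; exact: average_bounded.
Qed.

Lemma umean_ge0 psi c : (forall g, `|psi g| <= c) -> (forall g, 0 <= psi g) ->
  0 <= umean psi.
Proof.
move=> hc p0; have h := umean_cvg hc.
apply: (@closed_cvg _ _ U _ (average psi) (fun x => 0 <= x) _ _ _ h).
  exact: closed_ge.
by apply: filterE => N; rewrite mulr_ge0 ?invr_ge0 ?sumr_ge0.
Qed.

(** The translated sum runs over [a * F N], which differs from [F N] by a negligible set. *)
Lemma umean_translate psi c a : (forall g, `|psi g| <= c) ->
  umean (fun g => psi (a * g)%g) = umean psi.
Proof.
move=> hc.
have c0 : 0 <= c by apply: le_trans (hc 1%g).
apply: umean_eq.
rewrite (_ : average _ = (fun N => average psi N +
   (average (fun g => psi (a * g)%g) N - average psi N))); last first.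
  by apply/funext => N; rewrite addrC subrK.
rewrite -[X in _ --> X]addr0; apply: cvgD; first exact: umean_cvg hc.
suff h : average (fun g => psi (a * g)%g) N - average psi N @[N --> \oo] --> (0 : R).
  by apply: cvg_trans h; exact: cvg_app.
apply/norm_cvg0P.
have lim0 : (2 * c) * (#|` fsymdiff (ltranslate a (F N)) (F N)|%:R / #|` F N|%:R) @[N --> \oo] --> (0 : R).
  by rewrite -[X in _ --> X](mulr0 (2 * c)); apply: cvgMr; exact: (FFolner.2 a).
apply: (squeeze_cvgr _ (cvg_cst 0) lim0).
apply: filterE => N; rewrite normr_ge0 /= /average -mulrBr normrM normfV.
rewrite (gtr0_norm (cardF N)) mulrA mulrC ler_wpM2r ?invr_ge0 ?ler0n//.
set A := ltranslate a (F N).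
have -> : \sum_(g <- F N) psi (a * g)%g = \sum_(g <- A) psi g.
  by rewrite big_imfset//= => x y _ _; exact: mulgI.
rewrite (sum_fsetD _ (fsubsetIl A (F N))) (sum_fsetD _ (fsubsetIr A (F N))).
rewrite opprD addrACA subrr add0r; apply: le_trans (ler_normB _ _) _.
rewrite (_ : 2 * c * _ = c * #|` fsymdiff A (F N)|%:R + c * #|` fsymdiff A (F N)|%:R).
  apply: lerD; apply: le_trans (norm_sum_le _) _; try (by move=> *; exact: hc).
    rewrite ler_wpM2l// card_fset_le// /fsymdiff; apply/fsubsetP => x.
    by rewrite !inE; case: (x \in A); case: (x \in F N).
  rewrite ler_wpM2l// card_fset_le// /fsymdiff; apply/fsubsetP => x.
  by rewrite !inE; case: (x \in A); case: (x \in F N).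
by ring.
Qed.

End UltraMean.

Section LoebSpace.
Variables (G : groupType) (U : set_system nat).

(** The phantom argument [UU] ties the algebra of sets attached below to the ultrafilter. Sequences
    equal [U]-almost everywhere are not identified; the sets [star A] do not separate them. *)
Definition loeb_space (UU : UltraFilter U) : Type := nat -> G.

Variable UU : UltraFilter U.
Let X := loeb_space UU.

HB.instance Definition _ := gen_eqMixin (loeb_space UU).
HB.instance Definition _ := gen_choiceMixin (loeb_space UU).
HB.instance Definition _ := isPointed.Build (loeb_space UU) (fun=> 1%g).

(** The nonstandard extension of [A]. That it commutes with Boolean operations is the theorem of
    Los; complements are where [U] must be an ultrafilter. *)
Definition star (A : set G) : set (loeb_space UU) := [set x | U (fun N => A (x N))].

Lemma star0 : star set0 = set0.
Proof. by rewrite -subset0 => x /filter_not_empty. Qed.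

Lemma starT : star setT = setT.
Proof. by rewrite -subTset => x _; exact: filterT. Qed.

Lemma starC A : star (~` A) = ~` star A.
Proof.
apply/seteqP; split => x.
  move=> UnA UA.
  have /filter_ex [N [//]] : U ([set N | (~` A) (x N)] `&` [set N | A (x N)]).
  by exact: filterI.
by have [|//] := in_ultra_setVsetC (fun N => A (x N)) UU.
Qed.

Lemma starI A B : star (A `&` B) = star A `&` star B.
Proof.
apply/seteqP; split => x; last by move=> [UA UB]; exact: filterI UA UB.
by move=> UAB; split; apply: filterS UAB => N [].
Qed.

Lemma starU A B : star (A `|` B) = star A `|` star B.
Proof. by apply: setC_inj; rewrite setCU -!starC -starI setCU. Qed.

Lemma star_cst A g : star A (fun=> g) <-> A g.
Proof.
split=> [UA|Ag]; last exact: filterE.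
by have [N] := filter_ex UA.
Qed.

Let internal : set (set (loeb_space UU)) := range star.

Let internal0 : internal set0.
Proof. by exists set0 => //; exact: star0. Qed.

Let internalU : setU_closed internal.
Proof. by move=> _ _ [A _ <-] [B _ <-]; exists (A `|` B) => //; exact: starU. Qed.

Let internalC : setC_closed internal.
Proof. by move=> _ [A _ <-]; exists (~` A) => //; exact: starC. Qed.

HB.instance Definition _ := @isAlgebraOfSets.Build default_measure_display
  (loeb_space UU) internal internal0 internalU internalC.

Lemma measurable_star A : measurable (star A). Proof. by exists A. Qed.

(* Saturation: a decreasing sequence of nonempty sets [B k] of [G] has a common
   point among the sequences [x], namely any [x] with [x N] in [B N]. *)
Lemma star_bigcup_finite (A : set G) (B : nat -> set G) : \oo `<=` U ->
  star A `<=` \bigcup_k star (B k) ->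
  exists n, A `<=` \bigcup_(k < n) B k.
Proof.
move=> Uoo AB; apply: contrapT => /forallNP nAB.
have /choice [x hx] : forall n, exists g, A g /\ ~ (\bigcup_(k < n) B k) g.
  move=> n; apply: contrapT => /forallNP h; apply: (nAB n) => g Ag.
  by apply: contrapT => nB; exact: (h g).
have xA : star A x by apply: filterE => N; have [] := hx N.
have [k _ Ukx] := AB _ xA.
have Uk : U (fun N => (k < N)%N) by apply: Uoo; exists k.+1.
have /filter_ex [N [Bk kN]] :
  U ([set N | B k (x N)] `&` [set N | (k < N)%N]) by exact: filterI.
by have [_] := hx N; apply; exists k.
Qed.

End LoebSpace.
Arguments star {G U} UU A.

Section LoebMeasure.
Variables (R : realType) (G : groupType) (F : nat -> {fset G}).
Variables (U : set_system nat) (UU : UltraFilter U).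
Hypothesis FFolner : left_Folner R F.
Hypothesis Uoo : \oo `<=` U.

Let X := loeb_space G UU.

Definition indic_of (A : set G) (g : G) : R := (`[< A g >])%:R.

Lemma indic_of_bounded A g : `|indic_of A g| <= 1.
Proof. by rewrite /indic_of; case: `[< _ >]; rewrite ?normr1// normr0. Qed.

Lemma umean_sum m (u : nat -> G -> R) (c : nat -> R) :
  (forall k g, `|u k g| <= c k) ->
  umean F U (fun g => \sum_(0 <= k < m) u k g) = \sum_(0 <= k < m) umean F U (u k).
Proof.
move=> uc; elim: m => [|m IH].
  rewrite big_geq//; under [X in umean _ _ X]funext do rewrite big_geq//.
  exact: umean_cst.
rewrite big_nat_recr//=.
under [X in umean _ _ X]funext do rewrite big_nat_recr//=.
rewrite (@umeanD _ _ _ _ UU FFolner _ _ (\sum_(0 <= k < m) c k) (c m))// ?IH// => g.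
by apply: le_trans (ler_norm_sum _ _ _) _; apply: ler_sum => k _.
Qed.

(** Constant sequences recover [A] from [star UU A], so the content needs no choice of a
    representative. *)
Definition loeb_content (S : set X) : \bar R :=
  (umean F U (indic_of (fun g => S (fun=> g))))%:E.

Lemma loeb_content_star A : loeb_content (star UU A) = (umean F U (indic_of A))%:E.
Proof.
congr (umean F U _)%:E; apply/funext => g; congr (_%:R).
by congr nat_of_bool; apply: asbool_equiv_eq; exact: star_cst.
Qed.

(** Countable additivity on the algebra reduces to finite additivity: if a disjoint union of sets
    [star UU (B k)] is again some [star UU A], then by saturation finitely many of them cover it,
    and the partial sums become constant. Carathéodory extension does the rest. *)
Lemma loeb_probability_exists :
  exists P : probability (g_sigma_algebraType (@measurable _ X)) R,
    forall A, P (star UU A) = (umean F U (indic_of A))%:E.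
Proof.
have m0 : loeb_content set0 = 0%E.
  rewrite -(star0 _ UU) loeb_content_star (_ : indic_of _ = fun=> 0) ?umean_cst//.
  by apply/funext => g; rewrite /indic_of; case: asboolP.
have mge0 S : (0 <= loeb_content S)%E.
  rewrite lee_fin; apply: umean_ge0 (@indic_of_bounded _) _ => //.
have msa : semi_sigma_additive loeb_content.
  move=> S mS tS [A _ AS].
  have /choice [B hB] : forall k, exists B, star UU B = S k.
    by move=> k; have [B _ BS] := mS k; exists B.
  have [||n hn] := @star_bigcup_finite _ _ UU A B => //.
    by rewrite AS; move=> x [k _ Skx]; exists k => //; rewrite hB.
  rewrite -AS loeb_content_star.
  apply: cvg_near_cst; exists n => // m /= nm.
  under eq_bigr do rewrite -hB loeb_content_star.
  rewrite sumEFin; congr EFin.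
  rewrite -(umean_sum m (fun k => indic_of_bounded (B k))).
  congr umean; apply/funext => g.
  have BA k : B k `<=` A.
    move=> v /(star_cst UU) Bv; apply/(star_cst UU); rewrite AS; exists k => //.
    by rewrite -hB.
  rewrite {2}/indic_of; case: asboolP => [Ag|nAg]; last first.
    by rewrite big1// => k _; rewrite /indic_of; case: asboolP => // /BA.
  have [k kn Bk] := hn _ Ag.
  rewrite big_mkord (bigD1 (Ordinal (leq_trans kn nm)))//= {1}/indic_of.
  rewrite asboolT// big1 ?addr0// => k' k'k.
  rewrite /indic_of; case: asboolP => // Bk'; case/negP: k'k.
  apply/eqP/val_inj/(tS k' k) => //=.
  by exists (fun=> g); rewrite -!hB; split; apply/star_cst.
pose mu : {measure set X -> \bar R} :=
  HB.pack loeb_content (isMeasure.Build _ _ _ loeb_content m0 mge0 msa).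
pose nu := measure_extension mu.
have nuE A : nu (star UU A) = (umean F U (indic_of A))%:E.
  rewrite /nu /measure_extension measurable_mu_extE; last exact: measurable_star.
  exact: loeb_content_star.
have nuT : nu setT = 1%E.
  rewrite -(starT _ UU) nuE (_ : indic_of _ = fun=> 1) ?umean_cst//.
  by apply/funext => g; rewrite /indic_of asboolT.
pose P : probability (g_sigma_algebraType (@measurable _ X)) R :=
  HB.pack nu (Measure_isProbability.Build _ _ _ nu nuT).
by exists P.
Qed.

End LoebMeasure.

Section LoebSystem.
Variables (R : realType) (G : groupType) (F : nat -> {fset G}).
Variables (U : set_system nat) (UU : UltraFilter U).
Hypothesis FFolner : left_Folner R F.
Hypothesis Uoo : \oo `<=` U.

Let X := loeb_space G UU.

Definition loeb_measurable : measurableType _ := g_sigma_algebraType (@measurable _ X).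

Variable P : probability loeb_measurable R.
Hypothesis PE : forall A, P (star UU A) = (umean F U (indic_of R A))%:E.

Lemma loeb_measurable_star A : measurable (star UU A : set loeb_measurable).
Proof. by apply: sub_sigma_algebra; exact: measurable_star. Qed.

Definition loeb_shift (g : G) (x : loeb_measurable) : loeb_measurable :=
  fun N => (g * x N)%g.

Lemma loeb_shift_star g A :
  loeb_shift g @^-1` star UU A = star UU [set v | A (g * v)%g].
Proof. by []. Qed.

Lemma measurable_loeb_shift g : measurable_fun setT (loeb_shift g).
Proof.
apply: (@measurability _ _ loeb_measurable loeb_measurable setT (loeb_shift g)
  (@measurable _ X) erefl).
move=> _ [_ [A _ <-] <-]; rewrite setTI loeb_shift_star.
exact: loeb_measurable_star.
Qed.

(** Both measures agree on the sets [star UU A] by invariance of the mean, and these are stable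
    under intersection and generate. *)
Lemma loeb_shift_preserving g : measure_preserving P (loeb_shift g).
Proof.
split; first exact: measurable_loeb_shift.
pose phi : {mfun loeb_measurable >-> loeb_measurable} :=
  HB.pack (loeb_shift g) (isMeasurableFun.Build _ _ _ _ _ (measurable_loeb_shift g)).
move=> B mB; apply/esym; rewrite -[RHS]/(pushforward P phi B).
apply: (@measure_unique _ R loeb_measurable (@measurable _ X) (fun=> setT) erefl _ _ _ P (pushforward P phi)) mB => //.
- by move=> A C mA mC; exact: measurableI.
- by rewrite bigcup_const//; exists 0%N.
- move=> _ [A _ <-]; transitivity (P (star UU [set v | A (g * v)%g])); last by [].
  have := umean_translate UU FFolner Uoo g (indic_of_bounded R A).
  move=> h; apply: etrans (PE A) _; apply: etrans (esym (PE _)).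
  by rewrite -h.
- by move=> _; apply: le_lt_trans (probability_le1 P measurableT) (ltry _).
Qed.

Lemma loeb_action : measure_preserving_action P loeb_shift.
Proof.
split; first exact: loeb_shift_preserving.
  by apply/funext => x; apply/funext => N; rewrite /loeb_shift mul1g.
by move=> g g'; apply/funext => x; apply/funext => N; rewrite /loeb_shift /= mulgA.
Qed.

End LoebSystem.

Section LoebIntegral.
Variables (R : realType) (G : groupType) (F : nat -> {fset G}).
Variables (U : set_system nat) (UU : UltraFilter U).
Hypothesis FFolner : left_Folner R F.
Hypothesis Uoo : \oo `<=` U.
Variable P : probability (loeb_measurable G UU) R.
Hypothesis PE : forall A, P (star UU A) = (umean F U (indic_of R A))%:E.

Lemma indic_star_eventually m (A : nat -> set G) (x : loeb_space G UU) :
  U [set N | forall k, (k < m)%N -> indic_of R (A k) (x N) = \1_(star UU (A k)) x].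
Proof.
elim: m => [|m IH]; first exact: filterE.
have H : U [set N | indic_of R (A m) (x N) = \1_(star UU (A m)) x].
  rewrite indicE; case: (boolP (x \in _)) => [/set_mem h|/negP h].
    by apply: filterS h => N AN; rewrite /= /indic_of asboolT.
  have : star UU (~` A m) x by rewrite starC => h'; apply: h; exact: mem_set.
  by apply: filterS => N AN; rewrite /= /indic_of asboolF.
have := IH; apply: filterS2 H => N /= Hm IHN k; rewrite ltnS leq_eqVlt.
by move=> /orP[/eqP->//|/IHN].
Qed.

Section OneFunction.
Variables (psi : G -> R) (c : R) (psih : loeb_measurable G UU -> R).
Hypothesis psi_bounded : forall g, `|psi g| <= c.
Hypothesis psihP : forall x, (fun N => psi (x N)) @ U --> psih x.

(** Round [psi] down on a grid of mesh [e]; the integral of the resulting combination of indicators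
    is known from [PE]. Of the error [2 * e], one half comes from rounding, the other from replacing
    the limit [psih x] by some [psi (x N)]. *)
Lemma loeb_simple_approx (e : R) : 0 < e ->
  exists s : loeb_measurable G UU -> R, [/\ measurable_fun setT s,
    forall x, `|psih x - s x| <= 2 * e,
    exists c', forall x, `|s x| <= c' &
    `|\int[P]_x s x - umean F U psi| <= e].
Proof.
move=> e0.
have c0 : 0 <= c by apply: le_trans (psi_bounded 1%g).
pose key g := Num.truncn ((psi g + c) / e).
have keyP g : (key g)%:R * e <= psi g + c < (key g).+1%:R * e.
  rewrite -ler_pdivlMr// -ltr_pdivrMr//; apply: truncn_itv.
  by rewrite divr_ge0 ?(ltW e0)// -lerBlDr sub0r; have := psi_bounded g;
    rewrite ler_norml => /andP[].
pose m := (Num.truncn ((c + c) / e)).+1.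
have keym g : (key g < m)%N.
  rewrite ltnS le_truncn// ler_wpM2r ?invr_ge0 ?(ltW e0)// lerD2r.
  exact: le_trans (ler_norm _) (psi_bounded g).
pose a k : R := k%:R * e - c.
pose A k : set G := [set g | key g = k].
pose sg g := \sum_(k < m) a k * indic_of R (A k) g.
have sgE g : sg g = a (key g).
  rewrite /sg (bigD1 (Ordinal (keym g)))//= /indic_of asboolT// mulr1 big1 ?addr0//.
  move=> k kg; rewrite asboolF ?mulr0// => h; case/negP: kg; exact/eqP/val_inj.
have sg_psi g : `|psi g - sg g| <= e.
  have /andP[h1 h2] := keyP g; rewrite sgE /a; rewrite ger0_norm; last by lra.
  by move: h2; rewrite -natr1; lra.
pose s (x : loeb_measurable G UU) := \sum_(k < m) a k * \1_(star UU (A k)) x : R.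
have ms k : measurable_fun setT (\1_(star UU (A k)) : loeb_measurable G UU -> R).
  by apply: measurable_indic; exact: loeb_measurable_star.
have bs k (x : loeb_measurable G UU) : `|\1_(star UU (A k)) x : R| <= 1.
  by rewrite indicE; case: (_ \in _); rewrite ?normr1 ?normr0.
have [mS bS iS] := Rintegral_lincomb P (index_enum 'I_m) (fun k => a k)
  (fun k : 'I_m => ms k) (fun k => bs k).
exists s; split => //.
- move=> x.
  have U1 : U [set N | `|psih x - psi (x N)| < e].
    by have /cvgrPdist_lt := @psihP x; apply.
  have [N [/= h1 h2]] : exists N, `|psih x - psi (x N)| < e /\
      forall k, (k < m)%N -> indic_of R (A k) (x N) = \1_(star UU (A k)) x.
    apply: (@filter_ex _ U _); exact: filterI U1 (indic_star_eventually m A x).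
  have -> : s x = sg (x N) by apply: eq_bigr => k _; rewrite h2.
  rewrite -(subrK (psi (x N)) (psih x)) -addrA.
  apply: le_trans (ler_normD _ _) _; have := sg_psi (x N); move: h1; lra.
- by eexists; exact: bS.
- rewrite iS.
  have -> : \sum_(k < m) a k * \int[P]_x \1_(star UU (A k)) x = umean F U sg.
    rewrite -(big_mkord xpredT (fun k => a k * \int[P]_x \1_(star UU (A k)) x)).
    have -> : sg = fun g => \sum_(0 <= k < m) a k * indic_of R (A k) g.
      by apply/funext => g; rewrite big_mkord.
    rewrite (umean_sum UU FFolner m (c := fun k => `|a k|)); last first.
      by move=> k g; rewrite normrM ler_piMr// indic_of_bounded.
    apply: eq_bigr => k _.
    rewrite (umeanZ UU FFolner _ (indic_of_bounded R (A k))); congr (_ * _).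
    rewrite /Rintegral integral_indic//; last exact: loeb_measurable_star.
    by rewrite setIT /= PE.
  have sgb g : `|sg g| <= e + c.
    rewrite -(subrK (psi g) (sg g)); apply: le_trans (ler_normD _ _) (lerD _ _) => //.
    by rewrite distrC.
  have h : umean F U sg - umean F U psi = umean F U (fun g => sg g + -1 * psi g).
    rewrite (umeanD UU FFolner sgb (c' := c)) => [|g]; last by rewrite mulN1r normrN.
    by rewrite (umeanZ UU FFolner _ psi_bounded) mulN1r.
  rewrite h; apply: (umean_bounded UU FFolner) => g.
  by rewrite mulN1r distrC.
Qed.

Lemma loeb_integral : measurable_fun setT psih /\ \int[P]_x psih x = umean F U psi.
Proof.
have mp : measurable_fun setT psih.
  have /choice [s hs] : forall n, exists s : loeb_measurable G UU -> R,
      measurable_fun setT s /\ forall x, `|psih x - s x| <= 2 * n.+1%:R^-1.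
    move=> n; have [|s [ms hs _ _]] := @loeb_simple_approx n.+1%:R^-1.
      by rewrite invr_gt0.
    by exists s.
  apply: (measurable_fun_cvg (fun n => (hs n).1)) => x _.
  apply/cvgrPdist_le => e e0.
  have /cvgrPdist_le /(_ (e / 2)) [|n0 _ hn0] := @cvg_harmonic R.
    by rewrite divr_gt0.
  exists n0 => // n /hn0; rewrite /= sub0r normrN ger0_norm// => hn.
  by apply: le_trans ((hs n).2 x) _; rewrite mulrC -ler_pdivlMr.
split=> //; apply/eqP; rewrite -subr_eq0 -normr_le0; apply/ler_addgt0Pl => e e0.
have e3 : 0 < e / 3 by rewrite divr_gt0.
have [s [ms hs [c' hc'] hi]] := loeb_simple_approx e3.
have h := Rintegral_dist P mp ms hc' hs.
rewrite addr0 (_ : _ - _ = (\int[P]_x psih x - \int[P]_x s x) +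
   (\int[P]_x s x - umean F U psi)); last by rewrite addrA subrK.
by apply: le_trans (ler_normD _ _) _; apply: le_trans (lerD h hi) _; lra.
Qed.

End OneFunction.
End LoebIntegral.

(** * Complex-valued functions *)

Section ComplexTools.
Variable R : realType.
Implicit Types (w : Cplx R) (e : R).

Lemma cplx_normE w :
  `|w| = (Num.sqrt (complex.Re w ^+ 2 + complex.Im w ^+ 2))%:C :> Cplx R.
Proof. exact: (@normc_def R w). Qed.

Lemma cplx_le (a b : R) : ((a%:C : Cplx R) <= (b%:C : Cplx R)) = (a <= b).
Proof. exact: lecR. Qed.

Lemma cplx_lt (a b : R) : ((a%:C : Cplx R) < (b%:C : Cplx R)) = (a < b).
Proof. exact: ltcR. Qed.

(** Norms on [Cplx R] take values in [Cplx R] itself; this turns every positive tolerance into a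
    real one. *)
Lemma cplx_gt0P (e : Cplx R) : 0 < e -> exists2 r : R, 0 < r & e = r%:C.
Proof.
move=> e0; have : (0 : R[i]) < e by exact: e0.
by case: e {e0} => a b; rewrite ltcE /= => /andP[/eqP -> a0]; exists a.
Qed.

(** The boolean lets a pair of [l] and a part be coded as the single index [b + l.*2], recovered by
    [odd] and [./2]. *)
Definition cplx_part (b : bool) w : R := if b then complex.Im w else complex.Re w.

Lemma cplx_part_le b w : ((`|cplx_part b w|)%:C : Cplx R) <= `|w|.
Proof.
rewrite cplx_normE cplx_le -sqrtr_sqr ler_wsqrtr//.
by case: b; rewrite /= ?lerDr ?lerDl sqr_ge0.
Qed.

Lemma cplx_norm_le w :
  `|w| <= ((`|cplx_part false w| + `|cplx_part true w|)%:C : Cplx R).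
Proof.
rewrite cplx_normE cplx_le /= -[leRHS]ger0_norm ?addr_ge0// -sqrtr_sqr.
rewrite ler_wsqrtr// sqrrD !real_normK ?num_real// addrAC lerDl mulrn_wge0//.
Qed.

Lemma cplx_partB b w w' : cplx_part b (w - w') = cplx_part b w - cplx_part b w'.
Proof. by case: w => ? ?; case: w' => ? ?; case: b. Qed.

Lemma cplx_partD b w w' : cplx_part b (w + w') = cplx_part b w + cplx_part b w'.
Proof. by case: w => ? ?; case: w' => ? ?; case: b. Qed.

Lemma cplx_part0 b : cplx_part b (0 : Cplx R) = 0.
Proof. by case: b. Qed.

Lemma cplx_part_sum b (I : Type) (r : seq I) (f : I -> Cplx R) :
  cplx_part b (\sum_(v <- r) f v) = \sum_(v <- r) cplx_part b (f v).
Proof.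
by elim: r => [|x r IH]; rewrite ?big_nil ?cplx_part0// !big_cons cplx_partD IH.
Qed.

Lemma cplx_part_scale b n w :
  cplx_part b ((n%:R^-1 : Cplx R) * w) = n%:R^-1 * cplx_part b w.
Proof.
have -> : (n%:R^-1 : Cplx R) = (n%:R^-1 : R)%:C.
  have -> : (n%:R : Cplx R) = (n%:R : R)%:C by rewrite -(rmorph_nat (real_complex R)).
  by rewrite -(fmorphV (real_complex R)).
by case: w => a c; case: b => /=; rewrite ?mul0r ?subr0 ?addr0.
Qed.

Lemma cplx_eqP w w' : (forall b, cplx_part b w = cplx_part b w') -> w = w'.
Proof.
case: w => a c; case: w' => a' c' h.
by congr Complex; [exact: (h false)|exact: (h true)].
Qed.

Lemma cvg_cplxP (T : Type) (F : set_system T) (FF : Filter F) (u : T -> Cplx R) l :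
  u @ F --> l <-> forall b, (fun t => cplx_part b (u t)) @ F --> cplx_part b l.
Proof.
split => [/cvgrPdist_lt ul b|h].
  apply/cvgrPdist_lt => e e0; have e0' : 0 < (e%:C : Cplx R) by rewrite cplx_lt.
  apply: filterS (ul _ e0') => t /= ht; rewrite -cplx_partB -cplx_lt.
  exact: le_lt_trans (cplx_part_le _ _) ht.
apply/cvgrPdist_lt => _ /cplx_gt0P[e e0 ->].
have e2 : 0 < e / 2 by rewrite divr_gt0.
have /cvgrPdist_lt /(_ _ e2) h0 := h false.
have /cvgrPdist_lt /(_ _ e2) h1 := h true.
apply: filterS2 h0 h1 => t; rewrite -!cplx_partB => h0 h1.
apply: le_lt_trans (cplx_norm_le _) _; rewrite cplx_lt.
by rewrite [ltRHS](splitr e) ltrD.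
Qed.

End ComplexTools.

Section RowConvergence.
Variables (R : realType) (T : Type) (F : set_system T) (FF : Filter F).

Lemma cvg_row n (u : T -> 'I_n -> Cplx R) (l : 'I_n -> Cplx R) :
  (forall k, (fun t => u t k) @ F --> l k) ->
  (fun t => \row_k u t k) @ F --> (\row_k l k : 'rV[Cplx R]_n).
Proof.
move=> ul A [B MB BA].
have H : F [set t | forall k, B ord0 k (u t k)].
  apply: filter_forall => k; apply: ul.
  by have := MB ord0 k; rewrite mxE.
apply: (@filterS _ F _ _ _ _ H) => t Bt; apply: BA => k k'.
by rewrite (ord1 k) mxE; exact: Bt.
Qed.

Lemma cvg_within_row n (D : set (Cplx R)) (p : 'rV[Cplx R]_n -> Cplx R)
    (u : T -> 'I_n -> Cplx R) (l : 'I_n -> Cplx R) :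
  {within cpower D n, continuous p} ->
  (forall t k, D (u t k)) -> (forall k, D (l k)) ->
  (forall k, (fun t => u t k) @ F --> l k) ->
  (fun t => p (\row_k u t k)) @ F --> p (\row_k l k).
Proof.
move=> /subspace_continuousP cp Du Dl ul.
have Dl' : cpower D n (\row_k l k) by move=> k; rewrite mxE.
move=> A /(cp _ Dl') pA.
have H : F [set t | cpower D n (\row_k u t k) -> A (p (\row_k u t k))].
  exact: (cvg_row ul pA).
apply: (@filterS _ F _ _ _ _ H) => t; apply => k.
by rewrite mxE.
Qed.

End RowConvergence.

(** Along an ultrafilter, points [v m] where [p] exceeds [m] in norm converge coordinatewise in [D],
    and continuity of [p] at the limit contradicts this growth. *)
Lemma continuous_cpower_bounded (R : realType) n (D : set (Cplx R)) (p : 'rV[Cplx R]_n -> Cplx R) :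
  compact D -> {within cpower D n, continuous p} ->
  exists c : R, forall v, cpower D n v -> `|p v| <= (c%:C : Cplx R).
Proof.
move=> Dco cp; apply: contrapT => /forallNP nb.
have /choice [v hv] : forall m : nat, exists v, cpower D n v /\ ~ `|p v| <= (m%:R%:C : Cplx R).
  by move=> m; have /existsNP [v /not_implyP hv] := nb m%:R; exists v.
have [U [UU Uoo]] := @ultraFilterLemma _ (@eventually) _.
have /choice [l hl] : forall k, exists l, D l /\ (fun m => v m ord0 k) @ U --> l.
  move=> k; have := Dco; rewrite compact_ultra.
  move=> /(_ _ (ultra_fmap (fun m => v m ord0 k) UU)) [|l [Dl ul]]; last by exists l.
  by apply: (@filterE _ U) => m; apply: (hv m).1.
have vE m : v m = \row_k v m ord0 k by apply/rowP => k; rewrite mxE.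
have FU : Filter U by typeclasses eauto.
have := cvg_within_row FU cp (fun m k => (hv m).1 k) (fun k => (hl k).1)
  (fun k => (hl k).2).
rewrite (_ : (fun _ => _) = fun m => p (v m)); last first.
  by apply/funext => m; rewrite -vE.
move=> /cvgrPdist_lt /(_ 1 ltr01) near1.
have [m0 hm0] : exists m0 : nat, `|p (\row_k l k)| + 1 <= (m0%:R%:C : Cplx R).
  have /cplx_gt0P [r r0 ->] : 0 < `|p (\row_k l k)| + 1 by rewrite ltr_wpDl.
  by exists (Num.bound r); rewrite cplx_le ltW// archi_boundP// ltW.
have Um : U (fun m => (m0 <= m)%N) by apply: Uoo; exists m0.
have /filter_ex [m [h1 h2]] :
    U ([set m | `|p (\row_k l k) - p (v m)| < 1] `&` [set m | (m0 <= m)%N]).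
  exact: filterI.
have [_ []] := hv m.
apply: (@le_trans _ _ (m0%:R%:C : Cplx R)); last by rewrite cplx_le ler_nat.
apply: le_trans hm0; rewrite -[p (v m)](subKr (p (\row_k l k))).
apply: le_trans (ler_normB _ _) _; rewrite lerD2l.
exact: ltW.
Qed.

(** * From a point to a system *)

Lemma point_to_system (R : realType) (G : groupType)
    (F : nat -> {fset G}) (FFolner : left_Folner R F)
    (D : set (Cplx R)) (Dcompact : compact D)
    (j : nat -> nat) (h : forall l, 'I_(j l) -> G)
    (p : forall l, 'rV[Cplx R]_(j l) -> Cplx R)
    (pcont : forall l, {within cpower D (j l), continuous (p l)})
    (gamma : nat -> Cplx R) :
  (exists z : G -> Cplx R,
      (forall g, D (z g)) /\
      forall l,
        (fun N => #|` F N|%:R^-1 *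
           \sum_(g <- F N) p l (\row_i z (h l i * g)%g)) @ \oo --> gamma l) ->
  exists (d : measure_display) (X : measurableType d)
           (mu : probability X R) (T : G -> X -> X) (f : X -> Cplx R),
      [/\ measure_preserving_action mu T,
          complex_measurable_fun f,
          forall x, D (f x) &
          forall l,
            complex_integral mu (fun x => p l (\row_i f (T (h l i) x)))
              = gamma l].
Proof.
move=> [z [Dz zlim]].
have [U [UU Uoo]] := @ultraFilterLemma _ (@eventually) _.
have FU : Filter U by typeclasses eauto.
have [P PE] := @loeb_probability_exists R G F U UU FFolner Uoo.
have /choice [f hf] : forall x : loeb_measurable G UU, exists y, D y /\
    (fun N => z (x N)) @ U --> y.
  move=> x; have := Dcompact; rewrite compact_ultra.
  move=> /(_ _ (ultra_fmap (fun N => z (x N)) UU)) [|l [Dl ul]]; last by exists l.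
  by apply: (@filterE _ U) => N; exact: Dz.
exists _, (loeb_measurable G UU), P, (@loeb_shift G U UU), f; split.
- exact: (loeb_action FFolner Uoo PE).
- apply: (@measurability _ _ (loeb_measurable G UU) (complex_Borel R) setT f (@open (Cplx R)) erefl).
  move=> _ [V oV <-]; rewrite setTI.
  (* [z (x N)] lying in [V] for most [N] only puts [f x] in the closure of [V]; asking for a ball
     around [z (x N)] inside [V] leaves a margin that survives the limit. *)
  pose B k := [set g | ball (z g) ((k.+1%:R^-1 : R)%:C : Cplx R) `<=` V].
  have inv0 k : 0 < ((k.+1%:R^-1 : R)%:C : Cplx R) by rewrite cplx_lt invr_gt0.
  suff -> : f @^-1` V = \bigcup_k star UU (B k).
    by apply: bigcupT_measurable => k; exact: loeb_measurable_star.
  have lim x e : 0 < e -> U [set N | `|f x - z (x N)| < e].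
    by move=> e0; have /cvgrPdist_lt /(_ e e0) := (hf x).2.
  apply/seteqP; split => x.
    move=> /= /oV; rewrite -nbhs_ballE => -[_ /= /cplx_gt0P[e e0 ->] fV].
    have [k hk] : exists k : nat, k.+1%:R^-1 < e / 2.
      exists (Num.bound (e / 2)^-1); rewrite invf_plt ?posrE ?divr_gt0//.
      apply: lt_trans (archi_boundP _) _; last by rewrite ltr_nat.
      by rewrite invr_ge0 ltW// divr_gt0.
    exists k => //; apply: filterS (lim x _ (inv0 k)) => N /= fz w zw.
    apply: fV; rewrite -ball_normE /=.
    have zw' : `|z (x N) - w| < ((k.+1%:R^-1 : R)%:C : Cplx R) by exact: zw.
    rewrite -(subrK (z (x N)) (f x)) -addrA; apply: le_lt_trans (ler_normD _ _) _.
    apply: lt_trans (ltrD fz zw') _.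
    have -> : ((k.+1%:R^-1 : R)%:C : Cplx R) + (k.+1%:R^-1 : R)%:C =
       ((k.+1%:R^-1 + k.+1%:R^-1 : R)%:C : Cplx R) by rewrite -(rmorphD (real_complex R)).
    by rewrite cplx_lt [ltRHS]splitr ltrD.
  move=> [k _ Bk].
  have /filter_ex [N [/= BN]] : U ([set N | B k (x N)] `&`
      [set N | `|f x - z (x N)| < ((k.+1%:R^-1 : R)%:C : Cplx R)]).
    by apply: filterI => //; exact: lim.
  by rewrite distrC => fz; apply: BN.
- by move=> x; exact: (hf x).1.
move=> l; have [c hc] := continuous_cpower_bounded Dcompact (pcont l).
apply: cplx_eqP => b.
pose psi g := cplx_part b (p l (\row_i z (h l i * g)%g)).
pose psih x := cplx_part b (p l (\row_i f (loeb_shift (h l i) x))).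
have psib g : `|psi g| <= c.
  rewrite -cplx_le; apply: le_trans (cplx_part_le _ _) _; apply: hc => k.
  by rewrite mxE.
(* Shifting [x] by [h l i] replaces [x N] by [h l i * x N], so continuity of [p l] along [U]
   identifies [psih] with the limit of [psi]. *)
have psihP x : (fun N => psi (x N)) @ U --> psih x.
  apply: (cvg_cplxP FU _ _).1.
  apply: (cvg_within_row FU (pcont l)) => [t k|k|k] //.
  - exact: (hf _).1.
  - exact: (hf (loeb_shift (h l k) x)).2.
have [_ int] := loeb_integral FFolner PE psib psihP.
transitivity (\int[P]_x psih x); first by rewrite /psih; case: (b).
rewrite int; apply: (umean_cvg_eq UU Uoo).
have /(cvg_cplxP _ _ _).1 /(_ b) hb := zlim l.
suff -> : average F psi = (fun N => cplx_part b (#|` F N|%:R^-1 *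
    \sum_(g <- F N) p l (\row_i z (h l i * g)%g))) by exact: hb.
by apply/funext => N; rewrite /average cplx_part_scale cplx_part_sum.
Qed.

(** * From a system to averages *)

Section FiniteApproximation.
Variables (R : realType) (d : measure_display) (X : measurableType d).

Lemma compact_net (D : set (Cplx R)) (e : R) : compact D -> 0 < e ->
  exists s : seq (Cplx R), (forall c, c \in s -> D c) /\
    forall z, D z -> has (fun c => `|c - z| < (e%:C : Cplx R)) s.
Proof.
move=> Dco e0; have e0' : 0 < (e%:C : Cplx R) by rewrite cplx_lt.
have := Dco; rewrite compact_cover => /(_ _ D (fun c => ball c (e%:C : Cplx R))).
case=> [c _|z Dz|s sD Ds].
- exact: ball_open.
- by exists z => //; exact: ballxx.
exists (enum_fset s); split => [c /sD|z /Ds[c cs cz]]; first by rewrite inE.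
by apply/hasP; exists c => //; move: cz; rewrite -ball_normE.
Qed.

Lemma measurable_find (P : Cplx R -> X -> bool) (s : seq (Cplx R)) k :
  (forall c, measurable [set x | P c x]) ->
  measurable [set x | find (P^~ x) s = k].
Proof.
move=> mP; elim: s k => [|c s IH] k /=.
  have [->|k0] := eqVneq 0%N k.
    by rewrite (_ : [set _ | _] = setT); [exact: measurableT|apply/seteqP].
  rewrite (_ : [set _ | _] = set0); first exact: measurable0.
  by apply/seteqP; split => // x /= /eqP; rewrite (negbTE k0).
case: k => [|k].
  rewrite (_ : [set _ | _] = [set x | P c x]); first exact: mP.
  by apply/seteqP; split => x /=; case: (P c x).
rewrite (_ : [set _ | _] = ~` [set x | P c x] `&` [set x | find (P^~ x) s = k]).
  by apply: measurableI => //; exact: measurableC.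
apply/seteqP; split => x /=; case: (P c x) => //=; first by move=> [].
  by move=> [].
by move=> [_ ->].
Qed.

Variables (D : set (Cplx R)) (f : X -> Cplx R).
Hypothesis Dcompact : compact D.
Hypothesis mf : complex_measurable_fun f.
Hypothesis Df : forall x, D (f x).

Lemma measurable_near c (e : Cplx R) : measurable [set x | `|c - f x| < e].
Proof.
rewrite -[X in measurable X]setTI.
apply: (mf measurableT (Y := [set z : complex_Borel R | `|c - (z : Cplx R)| < e])).
apply: sub_sigma_algebra.
by have := @ball_open _ _ (c : Cplx R) e; rewrite -ball_normE.
Qed.

Lemma finite_valued_approx (e : R) : 0 < e ->
  exists (c : nat -> Cplx R) (idx : X -> nat), [/\ forall k, D (c k),
    forall k, measurable [set x | idx x = k] &
    forall x, `|c (idx x) - f x| < (e%:C : Cplx R)].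
Proof.
move=> e0; have [s [sD sP]] := compact_net Dcompact e0.
pose P c x := `|c - f x| < (e%:C : Cplx R).
(* Beyond the net the default is a value of [f], so that every [c k] lies in [D]. *)
exists (fun k => if (k < size s)%N then nth (f point) s k else f point).
exists (fun x => find (P^~ x) s); split => [k|k|x].
- by case: ifP => // ks; apply: sD; exact: mem_nth.
- by apply: measurable_find => c; exact: measurable_near.
have hs := sP _ (Df x); rewrite -has_find hs.
exact: (nth_find (f point) hs).
Qed.

Lemma measurable_countable_comp (I : countType) (Y : Type) (w : X -> I) (q : I -> Y)
    (S : set Y) : (forall v, measurable [set x | w x = v]) ->
  measurable [set x | S (q (w x))].
Proof.
move=> mw; rewrite (_ : [set _ | _] = \bigcup_v (if `[< S (q v) >]
   then [set x | w x = v] else set0)).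
  apply: countable_bigcupT_measurable => [|v]; first exact: countableP.
  by case: ifP => _; [exact: mw|exact: measurable0].
apply/seteqP; split => x /= => [Sx|[v _]]; first by exists (w x) => //; rewrite asboolT.
by case: asboolP => //= Si ->.
Qed.

Variables (n : nat) (T : 'I_n -> X -> X).
Hypothesis mT : forall k, measurable_fun setT (T k).
Variable p : 'rV[Cplx R]_n -> Cplx R.
Hypothesis pcont : {within cpower D n, continuous p}.

(** [p] is continuous only within [cpower D n], so [f] is approximated by [D]-valued functions with
    countably many values. For these measurability is a countable union, and it passes to the
    pointwise limit. *)
Lemma measurable_within_continuous b :
  measurable_fun setT (fun x => cplx_part b (p (\row_k f (T k x)))).
Proof.
have inv0 m : 0 < (m.+1%:R^-1 : R) by rewrite invr_gt0.
have /choice [c hc] : forall m, exists c : nat -> Cplx R, exists idx : X -> nat,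
    [/\ forall k, D (c k), forall k, measurable [set x | idx x = k] &
    forall x, `|c (idx x) - f x| < ((m.+1%:R^-1 : R)%:C : Cplx R)].
  by move=> m; exact: finite_valued_approx (inv0 m).
have /choice [idx hidx] := hc.
pose u m x (k : 'I_n) := c m (idx m (T k x)).
apply: (@measurable_fun_cvg _ _ _ _ (fun m x => cplx_part b (p (\row_k u m x k)))).
  move=> m _ S mS; rewrite setTI.
  pose w x := [ffun k : 'I_n => idx m (T k x)].
  pose q (v : {ffun 'I_n -> nat}) := cplx_part b (p (\row_k c m (v k))).
  have qw x : cplx_part b (p (\row_k u m x k)) = q (w x).
    by congr (cplx_part b (p _)); apply/rowP => k; rewrite !mxE ffunE.
  rewrite (_ : _ @^-1` _ = [set x | S (q (w x))]); last first.
    by apply/funext => x; rewrite /preimage /mkset qw.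
  apply: measurable_countable_comp => v.
  rewrite (_ : [set _ | _] = \bigcap_(k in [set: 'I_n]) (T k @^-1` [set x | idx m x = v k])).
    apply: fin_bigcap_measurable => // k _.
    rewrite -[X in measurable X]setTI; apply: mT => //.
    by have [_ + _] := hidx m; apply.
  apply/seteqP; split => x /=; first by move=> <- k _ /=; rewrite ffunE.
  by move=> h; apply/ffunP => k; rewrite ffunE; exact: h.
move=> x _.
apply: (cvg_cplxP _ _ _).1.
apply: (cvg_within_row _ pcont) => [m k|k|k] //.
  by have [+ _ _] := hidx m; apply.
apply/cvgrPdist_lt => _ /cplx_gt0P[e e0 ->].
have /cvgrPdist_lt /(_ e e0) [m0 _ hm0] := @cvg_harmonic R.
exists m0 => // m /hm0; rewrite /= sub0r normrN ger0_norm// => hm.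
rewrite distrC; have [_ _ +] := hidx m => /(_ (T k x)) /lt_trans; apply.
by rewrite cplx_lt.
Qed.

End FiniteApproximation.

Lemma Rintegral_measure_preserving (R : realType) (d : measure_display)
    (X : measurableType d) (mu : probability X R) (S : X -> X) (phi : X -> R) c :
  measure_preserving mu S -> measurable_fun setT phi -> (forall x, `|phi x| <= c) ->
  \int[mu]_x phi (S x) = \int[mu]_x phi x.
Proof.
move=> [mS SP] mphi phic; congr fine.
have mphi' : measurable_fun setT (EFin \o phi) by exact/measurable_EFinP.
have hi : mu.-integrable (S @^-1` setT) ((EFin \o phi) \o S).
  rewrite preimage_setT; apply: (@bounded_integrable _ _ _ _ (phi \o S) c) => [|x].
    exact: measurableT_comp.
  exact: phic.
have := integral_pushforward mS mphi' hi measurableT.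
rewrite preimage_setT => <-.
by apply: eq_measure_integral => A mA _; exact: SP.
Qed.

Lemma cplx_part_average (R : realType) b n (K : nat) (I : Type) (r : seq I)
    (f : 'I_K -> I -> Cplx R) :
  cplx_part b ((n%:R^-1 : Cplx R) * \sum_(k < K) \sum_(g <- r) f k g) =
  n%:R^-1 * \sum_(k < K) \sum_(g <- r) cplx_part b (f k g).
Proof.
rewrite cplx_part_scale cplx_part_sum; congr (_ * _).
by apply: eq_bigr => k _; rewrite cplx_part_sum.
Qed.

Lemma system_to_averages (R : realType) (G : groupType)
    (D : set (Cplx R)) (Dcompact : compact D)
    (j : nat -> nat) (h : forall l, 'I_(j l) -> G)
    (p : forall l, 'rV[Cplx R]_(j l) -> Cplx R)
    (pcont : forall l, {within cpower D (j l), continuous (p l)})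
    (gamma : nat -> Cplx R)
    (d : measure_display) (X : measurableType d) (mu : probability X R)
    (T : G -> X -> X) (f : X -> Cplx R) :
  measure_preserving_action mu T -> complex_measurable_fun f ->
  (forall x, D (f x)) ->
  (forall l, complex_integral mu (fun x => p l (\row_i f (T (h l i) x))) = gamma l) ->
  forall (A : {fset G}), A != fset0 -> forall (L : nat) (delta : R), 0 < delta ->
  exists (K : nat) (x : 'I_K -> X), (0 < K)%N /\
    forall l, (l < L)%N ->
      `| gamma l - (K * #|` A|)%:R^-1 *
           \sum_(k < K) \sum_(g <- A) p l (\row_i f (T (h l i * g)%g (x k))) |
        < (delta%:C : Cplx R).
Proof.
move=> [Tmp T1 TM] mf Df pgamma A A0 L delta d0.
have cA : #|` A|%:R != 0 :> R by rewrite pnatr_eq0 -lt0n cardfs_gt0.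
pose phi l b x := cplx_part b (p l (\row_i f (T (h l i) x))).
have mphi l b : measurable_fun setT (phi l b).
  exact: (measurable_within_continuous Dcompact mf Df (fun k => (Tmp _).1) (pcont l)).
have /choice [c hc] : forall l, exists c : R, forall b x, `|phi l b x| <= c.
  move=> l; have [c hc] := continuous_cpower_bounded Dcompact (pcont l).
  exists c => b x; rewrite -cplx_le; apply: le_trans (cplx_part_le _ _) _.
  by apply: hc => k; rewrite mxE.
have iphi l b : \int[mu]_x phi l b x = cplx_part b (gamma l).
  by rewrite -pgamma /phi; case: b.
(* The averaging over [A] is put inside the function, so a point [x] stands for its whole orbit
   pattern; by invariance the integral is unchanged. *)
pose v m x := \sum_(g <- A) #|` A|%:R^-1 * phi m./2 (odd m) (T g x).
have vP m := Rintegral_lincomb mu (enum_fset A) (fun=> #|` A|%:R^-1)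
  (fun g => measurableT_comp (mphi m./2 (odd m)) (Tmp g).1)
  (fun g x => hc m./2 (odd m) (T g x)).
have iv m : \int[mu]_x v m x = cplx_part (odd m) (gamma m./2).
  have [_ _ /= ->] := vP m.
  under eq_bigr do rewrite (Rintegral_measure_preserving (Tmp _) (mphi _ _) (hc _ _)) iphi.
  by rewrite big_const_seq count_predT iter_addr_0 -[_ *+ _]mulr_natl mulVKf.
pose u m x := v m x - cplx_part (odd m) (gamma m./2).
have mv m : measurable_fun setT (v m) by have [] := vP m.
have mu_ m : measurable_fun setT (u m) by apply: measurable_funB => //; exact: measurable_cst.
have /choice [c' hc'] : forall m, exists c' : R, forall x, `|u m x| <= c'.
  move=> m; have [_ + _] := vP m.
  move: (\sum_(k <- A) _) => b0 bv.
  exists (b0 + `|cplx_part (odd m) (gamma m./2)|) => x.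
  by apply: le_trans (ler_normB _ _) _; rewrite lerD2r; exact: bv.
have iu m : \int[mu]_x u m x = 0.
  have [_ bv _] := vP m.
  rewrite RintegralB//.
  - by rewrite iv Rintegral_cst//= probability_setT mulr1 subrr.
  - exact: bounded_integrable (mv m) bv.
  - by apply: (@bounded_integrable _ _ _ _ _ `|cplx_part (odd m) (gamma m./2)|).
(* A combination of the [u m] has integral 0, so it cannot exceed 1 everywhere. *)
have ucancel (s : nat -> R) : exists x, \sum_(m < L.*2) s m * u m x <= 1.
  apply: contrapT => /forallNP nx.
  have [mS bS] := Rintegral_lincomb mu (index_enum 'I_(L.*2)) (fun m => s m)
    (fun m : 'I_(L.*2) => mu_ m) (fun m => hc' m).
  under [X in _ = X -> _]eq_bigr do rewrite iu mulr0.
  rewrite big1// => iS.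
  have : \int[mu]_x (1 : R) <= \int[mu]_x (\sum_(m < L.*2) s m * u m x).
    apply: le_Rintegral => //.
    - by apply: (@bounded_integrable _ _ _ _ _ `|1|).
    - exact: bounded_integrable mS bS.
    - by move=> x _; rewrite leNgt; apply/negP => /ltW; exact: nx.
  by rewrite iS Rintegral_cst//= probability_setT mulr1 ler10.
pose cc := \sum_(m < L.*2) `|c' m|.
have ubound m x : (m < L.*2)%N -> `|u m x| <= cc.
  move=> mL; apply: le_trans (hc' m x) _.
  rewrite /cc (bigD1 (Ordinal mL))//=; apply: le_trans (ler_norm _) _.
  by rewrite lerDl sumr_ge0.
have d2 : 0 < delta / 2 by rewrite divr_gt0.
have [K [x [K0 hK]]] := greedy_average ubound ucancel d2.
have K0' : 0 < K%:R :> R by rewrite ltr0n.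
exists K, x; split => // l lL.
have part b : `|cplx_part b (gamma l - (K * #|` A|)%:R^-1 *
    \sum_(k < K) \sum_(g <- A) p l (\row_i f (T (h l i * g)%g (x k))))| < delta / 2.
  have := hK (b + l.*2)%N; rewrite {1}/u /v half_bit_double oddD odd_double addbF oddb.
  have -> : (b + l.*2 < L.*2)%N.
    by rewrite (@leq_trans l.+1.*2)// ?leq_double// doubleS; case: (b).
  move=> /(_ isT); rewrite cplx_partB cplx_part_average sumrB sumr_const card_ord.
  set w := cplx_part b (gamma l).
  under eq_bigr do rewrite -mulr_sumr.
  rewrite -mulr_sumr.
  have -> : \sum_(k < K) \sum_(g <- A) cplx_part b
      (p l (\row_i f (T (h l i * g)%g (x k)))) =
    \sum_(k < K) \sum_(g <- A) phi l b (T g (x k)).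
    apply: eq_bigr => k _; apply: eq_bigr => g _; congr (cplx_part b (p l _)).
    by apply/rowP => i; rewrite !mxE -TM.
  set S := \sum_(k < K) _.
  rewrite -[w *+ K]mulr_natr => hS.
  have -> : w - (K * #|` A|)%:R^-1 * S = - ((#|` A|%:R^-1 * S - w * K%:R) / K%:R).
    by rewrite natrM; field; rewrite cA gt_eqF.
  by rewrite normrN normrM normfV (gtr0_norm K0') ltr_pdivrMr.
apply: le_lt_trans (cplx_norm_le _) _; rewrite cplx_lt [ltRHS](splitr delta).
exact: ltrD.
Qed.

(** * From averages to a point, for complex-valued observables *)

Lemma averages_to_point (R : realType) (G : groupType)
    (Ginfinite : infinite_set [set: G])
    (F : nat -> {fset G}) (FFolner : left_Folner R F)
    (D : set (Cplx R)) (Dcompact : compact D)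
    (j : nat -> nat) (h : forall l, 'I_(j l) -> G)
    (p : forall l, 'rV[Cplx R]_(j l) -> Cplx R)
    (pcont : forall l, {within cpower D (j l), continuous (p l)})
    (gamma : nat -> Cplx R) :
  (forall A : {fset G}, A != fset0 ->
    forall L : nat, (0 < L)%N ->
    forall delta : R, 0 < delta ->
      exists (K : nat) (z : 'I_K -> G -> Cplx R),
        [/\ (0 < K)%N,
            forall k g, D (z k g) &
            forall l, (l < L)%N ->
              `| gamma l - (K * #|` A|)%:R^-1 *
                   \sum_(k < K) \sum_(g <- A) p l (\row_i z k (h l i * g)%g) |
                < (delta%:C : Cplx R)]) ->
  exists z : G -> Cplx R,
      (forall g, D (z g)) /\
      forall l,
        (fun N => #|` F N|%:R^-1 *
           \sum_(g <- F N) p l (\row_i z (h l i * g)%g)) @ \oo --> gamma l.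
Proof.
move=> averages.
(* With values in this subtype, membership in [D] survives the choice and gluing of patterns, and
   [Phi] is bounded everywhere. *)
pose Z := {w : Cplx R | D w}.
pose Phi m (z : G -> Z) g := cplx_part (odd m)
  (p m./2 (\row_i sval (z (h m./2 i * g)%g)) - gamma m./2).
pose H m := [fset h m./2 i | i : 'I_(j m./2)]%fset.
have Phi_local m z z' g :
    (forall k, k \in H m -> z (k * g)%g = z' (k * g)%g) -> Phi m z g = Phi m z' g.
  move=> zz; congr (cplx_part _ (p _ _ - _)); apply/rowP => i; rewrite !mxE zz//.
  exact: in_imfset.
have /choice [C Phi_bounded] : forall m, exists c : R, forall z g, `|Phi m z g| <= c.
  move=> m; have [c hc] := continuous_cpower_bounded Dcompact (pcont m./2).
  exists (c + `|cplx_part (odd m) (gamma m./2)|) => z g; rewrite /Phi cplx_partB.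
  apply: le_trans (ler_normB _ _) _; rewrite lerD2r -cplx_le.
  apply: le_trans (cplx_part_le _ _) _; apply: hc => k.
  by rewrite mxE; exact: (svalP (z _)).
have Phi_averages (A : {fset G}) : A != fset0 -> forall L (delta : R), 0 < delta ->
  exists (K : nat) (z : 'I_K -> G -> Z), (0 < K)%N /\ forall m, (m < L)%N ->
    `|(K * #|` A|)%:R^-1 * \sum_(k < K) \sum_(g <- A) Phi m (z k) g| < delta.
  (* [L.+1] is positive even for [L = 0], and exceeds [m./2] for every [m < L]. *)
  move=> A0 L delta d0; have [K [z [K0 Dz hz]]] := averages A A0 L.+1 isT delta d0.
  exists K, (fun k g => exist _ (z k g) (Dz k g)); split => // m mL.
  have m2 : (m./2 < L.+1)%N.
    rewrite ltnS; apply: leq_trans (ltnW mL).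
    by rewrite -{2}(odd_double_half m) -addnn addnA leq_addl.
  rewrite -cplx_lt; apply: le_lt_trans (hz _ m2).
  apply: le_trans (cplx_part_le (odd m) _); rewrite cplx_le cplx_partB distrC.
  have cA : #|` A|%:R != 0 :> R by rewrite pnatr_eq0 -lt0n cardfs_gt0.
  have cK : K%:R != 0 :> R by rewrite pnatr_eq0 -lt0n.
  rewrite cplx_part_average; set w := cplx_part (odd m) (gamma m./2).
  set S := \sum_(k < K) \sum_(g <- A) cplx_part _ _.
  have -> : \sum_(k < K) \sum_(g <- A) Phi m (fun g => exist _ (z k g) (Dz k g)) g =
      S - (K * #|` A|)%:R * w.
    rewrite /Phi; under eq_bigr do (under eq_bigr do rewrite cplx_partB;
      rewrite sumrB big_const_seq count_predT iter_addr_0).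
    rewrite sumrB sumr_const card_ord -mulrnA mulnC; congr (_ - _).
    by rewrite mulr_natl.
  by rewrite mulrBr mulKf// natrM mulf_neq0.
have [z hz] := generic_point Phi_local Phi_bounded Phi_averages Ginfinite FFolner.
exists (fun g => sval (z g)); split => [g|l]; first exact: (svalP (z g)).
apply/(cvg_cplxP _ _ _) => b; apply/cvgrPdist_le => e e0.
have [N0 hN0] := hz (b + l.*2)%N e e0; exists N0 => // N /= /hN0.
have cF : 0 < #|` F N|%:R :> R by rewrite ltr0n cardfs_gt0; have [] := FFolner.
have PhiE g : Phi (b + l.*2)%N z g =
    cplx_part b (p l (\row_i sval (z (h l i * g)%g))) - cplx_part b (gamma l).
  by rewrite /Phi half_bit_double oddD odd_double addbF oddb cplx_partB.
rewrite (eq_bigr _ (fun g _ => PhiE g)).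
rewrite sumrB big_const_seq count_predT iter_addr_0.
rewrite cplx_part_scale cplx_part_sum; set S := \sum_(g <- F N) _.
set w := cplx_part b (gamma l); rewrite -[w *+ _]mulr_natr => hS.
have -> : w - #|` F N|%:R^-1 * S = - ((S - w * #|` F N|%:R) / #|` F N|%:R).
  by field; rewrite gt_eqF.
by rewrite normrN normrM normfV (gtr0_norm cF) ler_pdivrMr.
Qed.

Theorem proposition3p1 (R : realType) (G : groupType)
    (Gcountable : countable [set: G]) (Ginfinite : infinite_set [set: G])
    (F : nat -> {fset G}) (FFolner : left_Folner R F)
    (D : set (Cplx R)) (Dcompact : compact D)
    (j : nat -> nat) (j_gt0 : forall l, (0 < j l)%N)
    (h : forall l, 'I_(j l) -> G)
    (p : forall l, 'rV[Cplx R]_(j l) -> Cplx R)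
    (pcont : forall l, {within cpower D (j l), continuous (p l)})
    (gamma : nat -> Cplx R) :
  [<->
    exists z : G -> Cplx R,
      (forall g, D (z g)) /\
      forall l,
        (fun N => #|` F N|%:R^-1 *
           \sum_(g <- F N) p l (\row_i z (h l i * g)%g)) @ \oo --> gamma l;

    exists (d : measure_display) (X : measurableType d)
           (mu : probability X R) (T : G -> X -> X) (f : X -> Cplx R),
      [/\ measure_preserving_action mu T,
          complex_measurable_fun f,
          forall x, D (f x) &
          forall l,
            complex_integral mu (fun x => p l (\row_i f (T (h l i) x)))
              = gamma l];

    forall A : {fset G}, A != fset0 ->
    forall L : nat, (0 < L)%N ->
    forall delta : R, 0 < delta ->
      exists (K : nat) (z : 'I_K -> G -> Cplx R),
        [/\ (0 < K)%N,
            forall k g, D (z k g) &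
            forall l, (l < L)%N ->
              `| gamma l - (K * #|` A|)%:R^-1 *
                   \sum_(k < K) \sum_(g <- A) p l (\row_i z k (h l i * g)%g) |
                < delta%:C] ].
Proof.
split; first exact: point_to_system.
split; last exact: averages_to_point.
move=> [d [X [mu [T [f [Tmp mf Df pgamma]]]]]] A A0 L _ delta d0.
have [K [x [K0 hx]]] :=
  system_to_averages Dcompact pcont Tmp mf Df pgamma A0 L d0.
(* Each sequence is the orbit of one of the chosen points, observed through [f]. *)
by exists K, (fun k g => f (T g (x k))).
Qed.
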